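(* Consider the real-power model and the RMPE algorithm with the gapless signal-processing routine and the real-power gapless rule for $m_\ell$ (all described in the context). Let $\epsilon>0$, $\rho\in(0,1)$, $\tau=\frac1\pi\log\frac{12}{\beta-\omega}$, and let $\alpha$ be a constant with $0<\alpha<\frac{\beta-\omega}{3}$. Let $\eta\le\frac{1}{8S(2S-1)}$, let $K$ be an integer with $K\ge3\eta^{-1}\tau$, and let $$N_{\mathrm{HR}}=2\left\lceil\frac{4}{\alpha^2}\left(\log\frac4\rho+\log\left(\left\lceil\log_2\frac{\eta}{\epsilon}\right\rceil+1\right)+\log(K+1)\right)\right\rceil.$$ Then with probability at least $1-\rho$ the output $E_L$ satisfies $\Lambda\subset E_L\subset B(\Lambda,\epsilon)$. The maximum runtime and total runtime are $T_{\max}=O(\eta K\epsilon^{-1})$ and $T_{\mathrm{total}}=O(\eta K^2N_{\mathrm{HR}}\epsilon^{-1})$.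
   Context: Real-power model: $H$ is a Hermitian operator with eigenvalues in $[0,1]$, and for every real $t\ge0$ one can apply (controlled) $U^t:=e^{-2\pi iHt}$ at cost (circuit depth) $t$. The initial state is $|\psi\rangle=\sum_{s=1}^Sc_s|\psi_s\rangle+c_{\mathrm{res}}|\psi_{\mathrm{res}}\rangle$ with $|\psi_s\rangle$ orthonormal, $H|\psi_s\rangle=\lambda_s|\psi_s\rangle$, $|\psi_{\mathrm{res}}\rangle$ a unit vector orthogonal to all $|\psi_s\rangle$, $\min_s|c_s|^2\ge\beta>0$, $|c_{\mathrm{res}}|^2\le\omega<\beta$; $\Lambda=\{\lambda_1,\dots,\lambda_S\}$, and it is assumed that $\Lambda\subset[0,0.9]$. Notation: $\mathbb{T}=\mathbb{R}/\mathbb{Z}$; $B(T,\eta)=\bigcup_{x\in T}[x-\eta,x+\eta]$ for $T\subset\mathbb{R}$, and $B_{\mathbb{T}}$ is the analogue on $\mathbb{T}$; $|\cdot|$ is Lebesgue measure. Hadamard test: one run with time $t$ uses one ancilla qubit and controlled-$U^t$ on $|\psi\rangle$ and returns an independent random $\pm1$ whose mean is $\mathrm{Re}\langle\psi|U^t|\psi\rangle$ (first variant) or $\mathrm{Im}\langle\psi|U^t|\psi\rangle$ (second variant); its cost is $t$. RMPE algorithm (parameters $\eta,K,N_{\mathrm{HR}}$, target $\epsilon$): set $E_{-1}=[0,0.9]$, $M_0=1$. For $\ell=0,1,2,\dots$: (i) if $\ell\ge1$ choose $m_\ell\ge2$ by the rule below and set $M_\ell=M_{\ell-1}m_\ell$;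 (ii) for each $k=0,\dots,K$ run the Hadamard test with $t=M_\ell k$ $N_{\mathrm{HR}}/2$ times for each variant, and let $y_\ell(k)$ be (average of real-variant outcomes)$+i\,$(average of imaginary-variant outcomes); set $y_\ell(-k)=\overline{y_\ell(k)}$; (iii) compute $Y_\ell\subset\mathbb{T}$ by the signal-processing routine; (iv) write $Y_\ell$ as a disjoint union of closed arcs, lift each arc to an interval of $\mathbb{R}$ and divide by $M_\ell$, obtaining intervals $I'_{\ell,1},\dots,I'_{\ell,S_\ell}$; for each $i$ pick an integer $q_{\ell,i}$ with $(I'_{\ell,i}+q_{\ell,i}/M_\ell)\cap E_{\ell-1}\ne\varnothing$, set $I_{\ell,i}=I'_{\ell,i}+q_{\ell,i}/M_\ell$ and $E_\ell=\bigcup_iI_{\ell,i}$; (v) if $\eta/M_\ell\le\epsilon$, stop and output $E_L:=E_\ell$. $T_{\max}$ is the largest $t$ used in any Hadamard test, $T_{\mathrm{total}}$ the sum of $t$ over all runs. Gapless signal-processing routine: with $\tau=\frac1\pi\log\frac{12}{\beta-\omega}$, $\sigma=\sqrt\tau$, $\hat\phi(k)=e^{-\pi(k\sigma/K)^2}$, $\phi_s=\sum_{k\in\mathbb{Z}}\hat\phi(k)$, let $X_\ell=\{x\in\mathbb{T}:|\sum_{|k|\le K}y_\ell(k)\hat\phi(k)e^{2\pi ikx}|>\frac{6\beta+5\omega}{11}\phi_s\}$; write $X_\ell$ as disjoint open arcs $(a_1,b_1),\dots,(a_q,b_q)$ in cyclic order, let $J$ be the set of $j$ with $a_j-b_{j-1}<\tau/K$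 (for $j=1$: $a_1+1-b_q<\tau/K$), and set $Y_\ell=\bigcup_i[a_i,b_i]\cup\bigcup_{j\in J}[b_{j-1},a_j]$ (modulo 1, $b_0:=b_q$). Rule for $m_\ell$ (real-power, gapless): choose $m_\ell\in[2,4]$ such that, with $G=B(E_{\ell-1},\frac{\eta}{2M_{\ell-1}})$, $(G+\frac{q}{M_{\ell-1}m_\ell})\cap G=\varnothing$ for all $q\in\mathbb{Z}\setminus\{0\}$. *)

(* Defs.v *)
From mathcomp Require Import all_boot all_order all_algebra.
From mathcomp Require Import all_classical all_reals all_analysis.
From mathcomp Require Import complex.
Import Order.TTheory GRing.Theory Num.Theory.
Import numFieldNormedType.Exports.

Set Implicit Arguments.
Unset Strict Implicit.
Unset Printing Implicit Defensive.

Local Open Scope classical_set_scope.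
Local Open Scope ring_scope.

Section RMPE.
Variable R : realType.
Local Notation C := (R[i]).

Definition cmod (z : C) : R :=
  Num.sqrt (complex.Re z ^+ 2 + complex.Im z ^+ 2).
Definition cconj (z : C) : C := Complex (complex.Re z) (- complex.Im z).
Definition creal (x : R) : C := Complex x 0.
Definition expi (th : R) : C := Complex (cos th) (sin th).

Definition adj (m p : nat) (A : 'M[C]_(m, p)) : 'M[C]_(p, m) :=
  map_mx cconj A^T.
Definition cinner (n : nat) (u v : 'cV[C]_n) : C := (adj u *m v) 0 0.

(* The Hamiltonian, given through a spectral decomposition
   H = V diag(mu) V^*  (V unitary, mu real): every Hermitian matrix is of
   this form.  U^t = e^{-2 pi i H t} = V diag(e^{-2 pi i mu_j t}) V^*. *)
Definition Hmat (n : nat) (V : 'M[C]_n) (mu : 'I_n -> R) : 'M[C]_n :=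
  V *m diag_mx (\row_j creal (mu j)) *m adj V.
Definition Upow (n : nat) (V : 'M[C]_n) (mu : 'I_n -> R) (t : R) : 'M[C]_n :=
  V *m diag_mx (\row_j expi (- (2 * pi * mu j * t))) *m adj V.

(* <psi| U^t |psi> : mean of the Hadamard test (Re / Im variants) *)
Definition hmean (n : nat) (V : 'M[C]_n) (mu : 'I_n -> R) (psi : 'cV[C]_n)
  (t : R) : C := cinner psi (Upow V mu t *m psi).

Definition Bset (A : set R) (r : R) : set R :=
  [set x | exists a, A a /\ `|x - a| <= r].
Definition shift (A : set R) (d : R) : set R := [set x + d | x in A].
Definition scale (A : set R) (M : R) : set R := [set x / M | x in A].

(* connected component in R of A containing x *)
Definition comp (A : set R) (x : R) : set R :=
  [set y | forall z, (x <= z <= y) \/ (y <= z <= x) -> A z].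
Definition is_comp (A : set R) (Cc : set R) : Prop :=
  exists x, A x /\ Cc = comp A x.
Definition bounded_set (A : set R) : Prop :=
  exists b, forall x, A x -> `|x| <= b.

(* Gapless signal processing.  Sets in T = R/Z are represented by their
   1-periodic lifts to R. *)
Definition phihat (K : nat) (tau : R) (k : int) : R :=
  expR (- (pi * (k%:~R * Num.sqrt tau / K%:R) ^+ 2)).
(* phi_s = sum_{k in Z} phihat k = phihat 0 + 2 sum_{k>=1} phihat k *)
Definition phis (K : nat) (tau : R) : R :=
  phihat K tau 0 +
  2 * limn ((series (fun k : nat => phihat K tau (k.+1)%:Z)) : nat -> R).

(* y : nat -> C gives y(0..K); extended by y(-k) = conj y(k) *)
Definition yfull (y : nat -> C) (k : int) : C :=
  if (0 <= k)%R then y `|k|%N else cconj (y `|k|%N).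

Definition Fsig (K : nat) (tau : R) (y : nat -> C) (x : R) : C :=
  \sum_(i < (2 * K).+1)
    let k := (i%:Z - K%:Z)%R in
    yfull y k * creal (phihat K tau k) * expi (2 * pi * k%:~R * x).

Definition Xset (K : nat) (tau beta omega : R) (y : nat -> C) : set R :=
  [set x | (6 * beta + 5 * omega) / 11 * phis K tau < cmod (Fsig K tau y x)].

(* Y_l (lifted): closure of X_l together with every complementary gap
   [b_{j-1}, a_j] of length < tau/K. *)
Definition Yset (K : nat) (tau beta omega : R) (y : nat -> C) : set R :=
  [set x | exists a b, a <= x <= b /\ b - a < tau / K%:R /\
      closure (Xset K tau beta omega y) a /\ closure (Xset K tau beta omega y) b].

(* Step (iv): E is an admissible E_l obtained from Y (lifted), M = M_l and
   Ep = E_{l-1}: one lift C_i of each arc of Y (a bounded component of the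
   lift, unique up to integer translation), with C_i / M meeting Ep, and
   E the union of the C_i / M. *)
Definition adm_update (Y : set R) (M : R) (Ep E : set R) : Prop :=
  exists Cs : set (set R),
    (forall Cc, Cs Cc -> [/\ is_comp Y Cc, bounded_set Cc &
                            exists x, Cc x /\ Ep (x / M)]) /\
    (forall Cc, is_comp Y Cc -> exists! q : int, Cs (shift Cc q%:~R)) /\
    E = \bigcup_(Cc in Cs) scale Cc M.

Definition good_m (eta Mp : R) (Ep : set R) (m : R) : Prop :=
  2 <= m <= 4 /\
  let G := Bset Ep (eta / (2 * Mp)) in
  forall q : int, q != 0 ->
    forall x, G x -> ~ G (x + q%:~R / (Mp * m)).

(* Sampling.  One round: for k = 0..K, variant v (false = Re, true = Im),
   repetition j < Nh (= N_HR/2): outcome true = +1, false = -1. *)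
Definition table (K Nh : nat) := {ffun 'I_K.+1 * bool * 'I_Nh -> bool}.

Definition sgnb (b : bool) : R := if b then 1 else -1.

Definition yest (K Nh : nat) (o : table K Nh) (k : nat) : C :=
  match insub k : option 'I_K.+1 with
  | Some kk =>
      Complex ((\sum_(j < Nh) sgnb (o (kk, false, j))) / Nh%:R)
              ((\sum_(j < Nh) sgnb (o (kk, true, j))) / Nh%:R)
  | None => 0
  end.

(* probability of the whole outcome table of one round at power M,
   outcomes being independent with the Hadamard-test means *)
Definition table_weight (g : R -> C) (K Nh : nat) (M : R) (o : table K Nh) : R :=
  \prod_(i : 'I_K.+1 * bool * 'I_Nh)
    let t := M * (nat_of_ord i.1.1)%:R in
    let mn := if i.1.2 then complex.Im (g t) else complex.Re (g t) in
    if o i then (1 + mn) / 2 else (1 - mn) / 2.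

(* The RMPE run, with choices resolved by an arbitrary (history-dependent)
   strategy chooseM / chooseE. *)
Record state (K Nh : nat) := St {
  hist : seq (table K Nh);
  lvl : nat;                (* index of the next round *)
  curM : R;                 (* M_{lvl-1} *)
  curE : set R;             (* E_{lvl-1} *)
  valid : bool;             (* all choices so far obeyed the rules *)
  tmax : R;
  ttot : R
}.

Variables (g : R -> C) (K Nh : nat) (tau beta omega eta eps : R).
Variable chooseM : seq (table K Nh) -> R -> set R -> R.
Variable chooseE : seq (table K Nh) -> R -> set R -> set R -> set R.

Definition init_state : state K Nh := St [::] 0 1 setT true 0 0.

Definition E_init : set R := [set x | 0 <= x <= 9 / 10].

Definition nextM (s : state K Nh) : R :=
  if lvl s == 0%N then 1 else curM s * chooseM (hist s) (curM s) (curE s).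
Definition prevE (s : state K Nh) : set R :=
  if lvl s == 0%N then E_init else curE s.
Definition validM (s : state K Nh) : bool :=
  if lvl s == 0%N then true
  else `[< good_m eta (curM s) (curE s) (chooseM (hist s) (curM s) (curE s)) >].

Definition step (s : state K Nh) (o : table K Nh) : state K Nh :=
  let M := nextM s in
  let Y := Yset K tau beta omega (yest o) in
  let E := chooseE (rcons (hist s) o) M (prevE s) Y in
  St (rcons (hist s) o) (lvl s).+1 M E
     [&& valid s, validM s & `[< adm_update Y M (prevE s) E >]]
     (Num.max (tmax s) (M * K%:R))
     (ttot s + \sum_(k < K.+1) (2 * Nh)%:R * (M * k%:R)).

Definition stopped (s : state K Nh) : bool :=
  (0 < lvl s)%N && (eta / curM s <= eps).

Variable Lam : set R.  (* the set Lambda of eigenvalues *)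
Definition success (s : state K Nh) : bool :=
  valid s && `[< Lam `<=` curE s /\ curE s `<=` Bset Lam eps >].

Fixpoint psucc (fuel : nat) (s : state K Nh) : R :=
  if stopped s then (if success s then 1 else 0) else
  match fuel with
  | 0 => 0
  | f.+1 => \sum_(o : table K Nh) table_weight g (nextM s) o * psucc f (step s o)
  end.

Fixpoint allruns (fuel : nat) (s : state K Nh) (P : state K Nh -> Prop) : Prop :=
  if stopped s then P s else
  match fuel with
  | 0 => False
  | f.+1 => forall o : table K Nh, allruns f (step s o) P
  end.

End RMPE.

Definition tau_of (R : realType) (beta omega : R) : R :=
  (1 / pi) * ln (12 / (beta - omega)).

Definition Nhalf (R : realType) (alpha rho eta eps : R) (K : nat) : nat :=
  `| Num.ceil (4 / alpha ^+ 2 *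
       (ln (4 / rho) + ln ((Num.ceil (ln (eta / eps) / ln 2))%:~R + 1)
        + ln (K%:R + 1))) |%N.

(* Main.v *)
(** Let phi(u) = sum_(|k| <= K) e^(- a k^2) cos (2 pi k u) be the truncated
    Gaussian theta sum with a = pi tau / K^2.  Up to the noise, the filtered
    signal at x is the average of phi (x - M nu) over the spectral measure of
    psi, so one needs that phi is almost nonnegative and concentrated near the
    integers.  Instead of Poisson summation we sum
    (2 cos (pi (x + j) / l))^(2 m) over j < l: only the Fourier modes divisible
    by l survive, and with m ~ l^2 / a the ratios C(2 m, m + k l) / C(2 m, m)
    tend to e^(- a k^2), while cos^2 t <= e^(- t^2) bounds the other side.
    Hence, when all the averages y(k) are alpha-accurate (Hoeffding and a union
    bound), X_l contains M Lam + Z and lies within tau / K of it, so the arcs of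
    Y_l are intervals around points of M Lam + Z of radius less than eta / 2.
    The rule for m_l separates the balls around M Lam from their nonzero integer
    translates, which makes the lifts unique and gives
    Lam <= E_l <= B(Lam, eta / (2 M_l)).  A good m_l exists because in the
    variable 1 / m_l in [1/4, 1/2] the resonances have total length < 1/4. *)

Require Import Defs.
From mathcomp Require Import all_boot all_order all_algebra.
From mathcomp Require Import all_classical all_reals all_analysis.
From mathcomp Require Import complex.
From mathcomp Require Import zify ring lra.
Import Order.TTheory GRing.Theory Num.Theory.
Import numFieldNormedType.Exports.
Local Open Scope classical_set_scope.
Local Open Scope ring_scope.
Set Implicit Arguments.
Unset Strict Implicit.
Unset Printing Implicit Defensive.

(** * Gaussian theta sums *)

(** The limit in [l] is taken only for the modes [k <= K]. The discrete weights are
    submultiplicative, as [e^(- a k^2)] is, so the modes beyond [K] are controlled at finite [m] and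
    no limit is exchanged with an infinite sum. The value of [tau] makes [e^(- pi tau)] equal to
    [(beta - omega) / 12]. The threshold [omega + 6 (beta - omega) / 11] is the sum of what can
    occur away from the lattice: residual mass [omega], leakage [7 (beta - omega) / 33] of the
    filter, and noise below [(beta - omega) / 3]. The residual state may sit at any frequency, so it
    enters only through its mass. The radius [eta / (2 M_l)] must be kept from round to round, and
    not merely [eps]: the next multiplier exists because of it. The success probability loses
    [rho / (L + 1)] in each of at most [L + 1] rounds, where [L] is the ceiling of the binary
    logarithm of [eta / eps], because [M] at least doubles. The runtime bounds hold for every
    outcome of the measurements. *)

Section CentralBinomial.
Variable R : realType.

(** The ratio of [C(2 m, m + p)] to [C(2 m, m)] as a product; truncated subtraction makes it vanish
    for [p > m], as the binomial does. *)
Definition binq (m p : nat) : R :=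
  \prod_(i < p) ((m - i)%N%:R / (m + i).+1%:R).

Lemma binqS m p :
  binq m p.+1 = binq m p * ((m - p)%N%:R / (m + p).+1%:R).
Proof. by rewrite /binq big_ord_recr. Qed.

Lemma binq0 m : binq m 0 = 1.
Proof. by rewrite /binq big_ord0. Qed.

Lemma binq_ge0 m p : 0 <= binq m p.
Proof. by apply: prodr_ge0 => i _; rewrite divr_ge0. Qed.

Lemma binq_eq0 m p : (m < p)%N -> binq m p = 0.
Proof.
by move=> mp; rewrite /binq (bigD1 (Ordinal mp)) //= subnn mul0r mul0r.
Qed.

(** The factors decrease with their index, so the [q] factors after the first [p] are at most the
    first [q]. This plays the role of [(p + q)^2 >= p^2 + q^2] for Gaussian weights. *)
Lemma binqD m p q : binq m (p + q) <= binq m p * binq m q.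
Proof.
elim: q => [|q IH]; first by rewrite addn0 binq0 mulr1.
rewrite addnS !binqS mulrA; apply: ler_pM => //; rewrite ?binq_ge0 ?divr_ge0 //.
apply: ler_pM; rewrite ?invr_ge0 ?ler_nat //; first lia.
by rewrite lef_pV2 ?posrE ?ltr0n // ler_nat; lia.
Qed.

Lemma binq_le1 m p : binq m p <= 1.
Proof.
rewrite /binq; apply: prodr_ile1 => i _; rewrite divr_ge0 //=.
by rewrite ler_pdivrMr ?ltr0n // mul1r ler_nat; lia.
Qed.

Lemma bin_binq m p : 'C(2 * m, m + p)%:R = 'C(2 * m, m)%:R * binq m p :> R.
Proof.
elim: p => [|p IH]; first by rewrite addn0 binq0 mulr1.
rewrite binqS mulrA -IH addnS.
have := mul_bin_left (2 * m) (m + p).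
rewrite (_ : (2 * m - (m + p) = m - p)%N); last lia.
move/(congr1 (fun n : nat => n%:R : R)); rewrite !natrM => E.
have nz : (m + p).+1%:R != 0 :> R by rewrite pnatr_eq0.
by apply: (mulfI nz); rewrite E; field.
Qed.

(** The factor of index [q < p] is [1 - (2 q + 1) / (m + q + 1)], at most
    [e^(- (2 q + 1) / (m + p))]; the odd numbers below [2 p] add up to [p^2]. *)
Lemma binq_le_expR m p : (0 < m)%N ->
  binq m p <= expR (- (p%:R ^+ 2 / (m + p)%N%:R)).
Proof.
move=> m0; have mp0 : 0 < (m + p)%N%:R :> R by rewrite ltr0n; lia.
suff H q : (q <= p)%N -> binq m q <= expR (- (q%:R ^+ 2 / (m + p)%N%:R)) by exact: H.
elim: q => [|q IH] qp; first by rewrite binq0 expr0n mul0r oppr0 expR0.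
rewrite binqS (_ : - _ = - (q%:R ^+ 2 / (m + p)%N%:R)
   + - ((q + q.+1)%N%:R / (m + p)%N%:R)); last first.
  by rewrite -opprD -mulrDl [(q + q.+1)%N%:R]natrD -(natr1 q); congr (- (_ / _)); ring.
rewrite expRD; apply: ler_pM; rewrite ?binq_ge0 ?divr_ge0 //; first exact/IH/ltnW.
have q1 : 0 < (m + q).+1%:R :> R by rewrite ltr0n.
have [mq|qm] := leqP m q; first by rewrite (eqP mq) mul0r expR_ge0.
apply: le_trans (expR_ge1Dx _).
rewrite natrB 1?ltnW // (_ : _ / _ = 1 - (q + q.+1)%N%:R / (m + q).+1%:R).
  rewrite lerD2l lerN2 ler_wpM2l // lef_pV2 ?posrE // ler_nat; lia.
rewrite -[(m + q).+1]addn1 -[q.+1]addn1 !natrD; field.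
by rewrite -natrD natr1 pnatr_eq0.
Qed.

(** The same computation on the inverse factors [1 + (2 q + 1) / (m - q)]. *)
Lemma binq_ge_expR m p : (p < m)%N ->
  expR (- (p%:R ^+ 2 / (m - p)%N%:R)) <= binq m p.
Proof.
move=> pm; have mp0 : 0 < (m - p)%N%:R :> R by rewrite ltr0n; lia.
suff H q : (q <= p)%N -> expR (- (q%:R ^+ 2 / (m - p)%N%:R)) <= binq m q by exact: H.
elim: q => [|q IH] qp; first by rewrite binq0 expr0n mul0r oppr0 expR0.
rewrite binqS (_ : - _ = - (q%:R ^+ 2 / (m - p)%N%:R)
   + - ((q + q.+1)%N%:R / (m - p)%N%:R)); last first.
  by rewrite -opprD -mulrDl [(q + q.+1)%N%:R]natrD -(natr1 q); congr (- (_ / _)); ring.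
rewrite expRD; apply: ler_pM; rewrite ?expR_ge0 //; first exact/IH/ltnW.
have q1 : 0 < (m - q)%N%:R :> R by rewrite ltr0n; lia.
rewrite expRN -[X in _ <= X]invf_div lef_pV2 ?posrE ?expR_gt0 ?divr_gt0 ?ltr0Sn //.
apply: le_trans (expR_ge1Dx _).
rewrite (_ : (m + q).+1%:R / _ = 1 + (q + q.+1)%N%:R / (m - q)%N%:R).
  by rewrite lerD2l ler_wpM2l // lef_pV2 ?posrE // ler_nat; lia.
rewrite natrB; last lia.
rewrite -[(m + q).+1]addn1 -[q.+1]addn1 !natrD; field.
by rewrite -natrB ?pnatr_eq0; lia.
Qed.

End CentralBinomial.

(** * Powers of the cosine summed over equally spaced points *)

Section CosSums.
Variable R : realType.
Implicit Types x y th : R.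

Lemma cosDn2pi x n : cos (x + 2 * pi * n%:R) = cos x.
Proof.
rewrite (_ : 2 * pi * n%:R = (pi *+ 2) *+ n); last first.
  by rewrite -mulrnA -[pi *+ _]mulr_natr natrM; ring.
by rewrite (periodicn (@cosD2pi R)).
Qed.

Lemma cosDz2pi x (z : int) : cos (x + 2 * pi * z%:~R) = cos x.
Proof.
case: z => n; first by rewrite -pmulrn cosDn2pi.
rewrite NegzE mulrNz -pmulrn -(cosDn2pi (x + _) n.+1); congr cos; ring.
Qed.

Lemma sinDn2pi x n : sin (x + 2 * pi * n%:R) = sin x.
Proof.
rewrite (_ : 2 * pi * n%:R = (pi *+ 2) *+ n); last first.
  by rewrite -mulrnA -[pi *+ _]mulr_natr natrM; ring.
by rewrite (periodicn (@sinD2pi R)).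
Qed.

Lemma sin_pi_frac_neq0 (l p : nat) : (0 < l)%N -> ~~ (l %| p)%N ->
  sin (pi * p%:R / l%:R) != 0 :> R.
Proof.
move=> l0 lp; have lR : 0 < l%:R :> R by rewrite ltr0n.
have -> : pi * p%:R / l%:R = pi * (p %% l)%N%:R / l%:R + pi *+ (p %/ l) :> R.
  rewrite {1}(divn_eq p l) natrD natrM -mulr_natr; field; exact: lt0r_neq0.
rewrite (alternatingn (@sinDpi R)) mulf_eq0 signr_eq0 /=.
have r0 : (0 < p %% l)%N by rewrite lt0n.
apply/lt0r_neq0/sin_gt0_pi; rewrite divr_gt0 ?mulr_gt0 ?pi_gt0 ?ltr0n //=.
rewrite ltr_pdivrMr // ltr_pM2l ?pi_gt0 // ltr_nat; exact: ltn_pmod.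
Qed.

(* Summation by telescoping after multiplication by 2 sin(pi p / l). *)
Lemma sum_cos_arith (l p : nat) x : (0 < l)%N -> ~~ (l %| p)%N ->
  \sum_(j < l) cos (2 * (pi * (x + j%:R) / l%:R) * p%:R) = 0.
Proof.
move=> l0 lp; have lR : l%:R != 0 :> R by rewrite pnatr_eq0 -lt0n.
have nz := sin_pi_frac_neq0 l0 lp.
apply: (mulfI nz); rewrite mulr0 mulr_sumr.
pose u (j : nat) := sin (2 * (pi * (x + j%:R) / l%:R) * p%:R - pi * p%:R / l%:R) / 2.
rewrite (eq_bigr (fun j : 'I_l => u j.+1 - u j)); last first.
  move=> j _; rewrite /u -mulrBl.
  set A := 2 * (pi * (x + j%:R) / l%:R) * p%:R.
  have -> : 2 * (pi * (x + j.+1%:R) / l%:R) * p%:R - pi * p%:R / l%:R =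
      A + pi * p%:R / l%:R by rewrite /A -natr1; field.
  by rewrite sinD sinB; field.
rewrite -(big_mkord xpredT (fun j => u j.+1 - u j)) telescope_sumr //.
apply/eqP; rewrite subr_eq0 /u; apply/eqP; congr (_ / 2).
rewrite -[RHS](sinDn2pi _ p); congr sin; field; exact: lR.
Qed.

Lemma sum_cos_arith_dvd (l k : nat) x : (0 < l)%N ->
  \sum_(j < l) cos (2 * (pi * (x + j%:R) / l%:R) * (k * l)%:R) =
  l%:R * cos (2 * pi * k%:R * x).
Proof.
move=> l0; have lR : l%:R != 0 :> R by rewrite pnatr_eq0 -lt0n.
rewrite (eq_bigr (fun=> cos (2 * pi * k%:R * x))); last first.
  move=> j _; rewrite -(cosDn2pi (2 * pi * k%:R * x) (k * j)); congr cos.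
  by rewrite !natrM; field.
by rewrite sumr_const card_ord -[LHS]mulr_natl.
Qed.

Lemma expiD x y : expi (x + y) = expi x * expi y.
Proof. by rewrite /expi cosD sinD; simpc; congr Complex; ring. Qed.

Lemma expi0 : expi 0 = 1 :> R[i].
Proof. by rewrite /expi cos0 sin0. Qed.

Lemma expiX x n : expi x ^+ n = expi (n%:R * x).
Proof.
elim: n => [|n IH]; first by rewrite mul0r expi0.
by rewrite exprS IH -expiD -natr1 mulrDl mul1r addrC.
Qed.

Lemma Re_sum (I : Type) (r : seq I) (P : pred I) (F : I -> R[i]) :
  complex.Re (\sum_(i <- r | P i) F i) = \sum_(i <- r | P i) complex.Re (F i).
Proof. by apply: (big_morph (@complex.Re R)) => // -[a b] [c d]. Qed.

Lemma cos_pow_sum th n : (2 * cos th) ^+ n =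
  \sum_(i < n.+1) 'C(n, i)%:R * cos (n%:R * th - 2 * i%:R * th).
Proof.
transitivity (complex.Re ((expi th + expi (- th)) ^+ n)).
  have -> : expi th + expi (- th) = (2 * cos th)%:C%C.
    by rewrite /expi cosN sinN; simpc; congr Complex; ring.
  by rewrite -rmorphXn.
rewrite exprDn Re_sum; apply: eq_bigr => i _.
rewrite !expiX -expiD -mulr_natl.
have -> : (n - i)%:R * th + i%:R * - th = n%:R * th - 2 * i%:R * th.
  by rewrite natrB -1?ltnS // ; ring.
by rewrite -(rmorph_nat (real_complex R)) /= mul0r subr0.
Qed.

(** The terms [m - p] and [m + p] of the binomial sum agree, by symmetry of the binomials and parity
    of the cosine. *)
Lemma cos_pow_binq m th : (2 * cos th) ^+ (2 * m) = 'C(2 * m, m)%:R *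
  (1 + 2 * \sum_(1 <= p < m.+1) binq R m p * cos (2 * th * p%:R)).
Proof.
rewrite cos_pow_sum.
rewrite -(big_mkord xpredT (fun i => 'C(2 * m, i)%:R * cos ((2 * m)%:R * th - 2 * i%:R * th))).
rewrite (@big_cat_nat _ _ _ m) //=; last lia.
rewrite [X in _ + X]big_nat_recl; last lia.
rewrite (_ : \sum_(0 <= i < m) _ =
  \sum_(1 <= p < m.+1) 'C(2 * m, m)%:R * (binq R m p * cos (2 * th * p%:R))); last first.
  rewrite big_nat_rev /= [RHS]big_add1 /=; apply: eq_big_nat => i /andP[_ im].
  rewrite mulrA -bin_binq -[in RHS]bin_sub; last lia.
  rewrite (_ : 0 + m - i.+1 = 2 * m - (m + i.+1))%N; last lia.
  congr (_ * cos _); rewrite natrB; last lia.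
  by rewrite natrD natrM; ring.
rewrite (_ : \sum_(m <= i < 2 * m) _ =
  \sum_(1 <= p < m.+1) 'C(2 * m, m)%:R * (binq R m p * cos (2 * th * p%:R))); last first.
  rewrite -{1}[m]add0n big_addn big_add1 /=.
  rewrite (_ : 2 * m - m = m)%N; last lia.
  apply: eq_big_nat => i /andP[_ im].
  rewrite mulrA -bin_binq (_ : (i + m).+1 = m + i.+1)%N; last lia.
  congr (_ * _); rewrite -cosN; congr cos.
  by rewrite natrD natrM; ring.
rewrite -!mulr_sumr natrM (_ : 2 * m%:R * th - _ = 0) ?cos0; last ring.
ring.
Qed.

Lemma sum_nat_dvd (V : nmodType) (g : nat -> V) (l n : nat) : (0 < l)%N ->
  \sum_(0 <= p < n * l | (l %| p)%N) g p = \sum_(0 <= k < n) g (k * l)%N.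
Proof.
move=> l0; elim: n => [|n IH]; first by rewrite mul0n !big_geq.
rewrite big_nat_recr //= -IH mulSn addnC (@big_cat_nat _ _ _ (n * l)%N) ?leq_addr //=.
congr (_ + _); rewrite big_ltn_cond; last lia.
rewrite dvdn_mull // big1_seq ?addr0 // => i /andP[/dvdnP[k ->]].
rewrite mem_index_iota addnC -mulSn => /andP[]; rewrite ltn_mul2r ltn_mul2r; lia.
Qed.

(** The discrete theta sum, with [binq] at [k l] in place of [e^(- a k^2)]. The bound [n] is
    exclusive: [m.+1] gives all modes, [K.+1] the truncation. *)
Definition phiB (m l n : nat) x : R :=
  1 + 2 * \sum_(1 <= k < n) binq R m (k * l) * cos (2 * pi * k%:R * x).

Lemma sum_cos_pow (m l : nat) x : (0 < l)%N ->
  \sum_(j < l) (2 * cos (pi * (x + j%:R) / l%:R)) ^+ (2 * m) =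
  l%:R * 'C(2 * m, m)%:R * phiB m l m.+1 x.
Proof.
move=> l0; under eq_bigr do rewrite cos_pow_binq.
rewrite -mulr_sumr big_split /= sumr_const card_ord -mulr_sumr exchange_big /=.
rewrite /phiB [l%:R * _]mulrC -mulrA; congr (_ * _); rewrite mulrDr mulr1; congr (_ + _).
rewrite mulrCA; congr (_ * _).
pose g p := \sum_(j < l) binq R m p * cos (2 * (pi * (x + j%:R) / l%:R) * p%:R).
rewrite -/(g _) mulr_sumr.
have gdvd k : g (k * l)%N = l%:R * (binq R m (k * l) * cos (2 * pi * k%:R * x)).
  by rewrite /g -mulr_sumr sum_cos_arith_dvd // mulrCA.
under [RHS]eq_bigr do rewrite -gdvd.
(* Adding the mode [p = 0] on both sides lets the sum over multiples of [l] start at 0. *)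
apply: (addrI (g 0%N)).
have -> : g 0%N = g (0 * l)%N by [].
rewrite -(big_ltn (n := m.+1) (m:=0) (F := fun k => g (k * l)%N)) // -sum_nat_dvd //.
(* The terms beyond [m] vanish, so the range may be extended to a multiple of [l]. *)
rewrite mul0n -big_ltn // (@big_cat_nat _ _ _ m.+1 0 (m.+1 * l)) //=; last nia.
rewrite [X in _ = _ + X]big1_seq ?addr0; last first.
  move=> p /andP[_]; rewrite mem_index_iota => /andP[mp _].
  by rewrite /g big1 // => j _; rewrite binq_eq0 ?mul0r.
rewrite [LHS](bigID (fun p => l %| p)%N) /= [X in _ + X]big1 ?addr0 // => p lp.
by rewrite /g -mulr_sumr sum_cos_arith ?mulr0.
Qed.

End CosSums.

(** * Monotonicity from derivatives and the Gaussian bound on the cosine *)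

Section RealAux.
Variable R : realType.
Implicit Types (f df : R -> R).

Lemma ger_of_derive_le0 f df (a b : R) : a <= b ->
  (forall x : R, is_derive x 1 f (df x)) ->
  (forall x, a <= x <= b -> df x <= 0) -> f b <= f a.
Proof.
move=> ab dfx df0.
have cf : continuous f.
  by move=> x; apply/differentiable_continuous/derivable1_diffP; have [] := dfx x.
have [c] := MVT_segment ab (fun x _ => dfx x) (continuous_subspaceT cf).
rewrite in_itv /= => /df0 c0 E.
by rewrite -subr_le0 E mulr_le0_ge0 // subr_ge0.
Qed.

Lemma ler_of_derive_ge0 f df (a b : R) : a <= b ->
  (forall x : R, is_derive x 1 f (df x)) ->
  (forall x, a <= x <= b -> 0 <= df x) -> f a <= f b.
Proof.
move=> ab dfx df0; rewrite -lerN2.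
apply: (@ger_of_derive_le0 (fun x => - f x) (fun x => - df x)) => // x.
by move=> xab; rewrite oppr_le0 df0.
Qed.

Lemma mulr_cos_le_sin (x : R) : 0 <= x <= pi / 2 -> x * cos x <= sin x.
Proof.
move=> /andP[x0 xpi]; rewrite -subr_ge0.
rewrite -[X in X <= _](_ : sin 0 - 0 * cos 0 = 0); last by rewrite sin0 mul0r subr0.
apply: (@ler_of_derive_ge0 (fun y => sin y - y * cos y) (fun y => y * sin y)) => //.
  move=> y; apply: is_derive_eq.
  by rewrite /GRing.scale /=; ring.
move=> y /andP[y0 yx]; rewrite mulr_ge0 // sin_ge0_pi // y0 /=.
have := pi_ge0 R; lra.
Qed.

(** The derivative of [cos x e^(x^2 / 2)] has the sign of [x cos x - sin x], so this product
    decreases from 1. *)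
Lemma cos_le_expR (x : R) : 0 <= x <= pi / 2 -> cos x <= expR (- (x ^+ 2 / 2)).
Proof.
move=> /andP[x0 xpi]; rewrite expRN -[_^-1]mul1r ler_pdivlMr ?expR_gt0 //.
rewrite -[X in _ <= X](_ : cos 0 * expR (0 ^+ 2 / 2) = 1); last first.
  by rewrite cos0 expr0n mul0r expR0 mulr1.
apply: (@ger_of_derive_le0 (fun y => cos y * expR (y ^+ 2 / 2))
   (fun y => expR (y ^+ 2 / 2) * (y * cos y - sin y))) => //.
  move=> y.
  have ? : is_derive y 1 (fun z : R => z ^+ 2 / 2) y.
    by apply: is_derive_eq; rewrite /GRing.scale /=; field.
  have ? : is_derive y 1 (fun z : R => expR (z ^+ 2 / 2)) (expR (y ^+ 2 / 2) * y).
    exact: (@is_derive1_comp R expR (fun z : R => z ^+ 2 / 2)).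
  by apply: is_derive_eq; rewrite /GRing.scale /=; ring.
move=> y /andP[y0 yx]; rewrite mulr_ge0_le0 ?expR_ge0 // subr_le0.
by apply: mulr_cos_le_sin; rewrite y0 (le_trans yx).
Qed.

Lemma cos_sqr_le_expR (x : R) : `|x| <= pi / 2 -> cos x ^+ 2 <= expR (- x ^+ 2).
Proof.
move=> xpi; rewrite -cos_norm -[x ^+ 2]real_normK ?num_real //.
rewrite (_ : - _ = - (`|x| ^+ 2 / 2) + - (`|x| ^+ 2 / 2)); last by field.
rewrite expRD -expr2 lerXn2r ?nnegrE ?expR_ge0 ?cos_ge0_pihalf //.
  by rewrite xpi andbT (le_trans _ (normr_ge0 x)) // oppr_le0 divr_ge0 ?pi_ge0.
by apply: cos_le_expR; rewrite normr_ge0.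
Qed.

Lemma sum_expr_le (r : R) n : 0 <= r < 1 ->
  \sum_(0 <= i < n) r ^+ i.+1 <= r / (1 - r).
Proof.
move=> /andP[r0 r1]; have r1' : 0 < 1 - r by rewrite subr_gt0.
have -> : \sum_(0 <= i < n) r ^+ i.+1 = r * (1 - r ^+ n) / (1 - r).
  elim: n => [|n IH]; first by rewrite big_geq // expr0 subrr mulr0 mul0r.
  by rewrite big_nat_recr //= IH !exprS; field; exact: lt0r_neq0.
rewrite ler_pM2r ?invr_gt0 // ler_piMr // gerBl exprn_ge0 //.
Qed.

End RealAux.

(** * Bounds for the truncated theta sum by passage to the limit *)

Section Theta.
Variable R : realType.
Implicit Types a x : R.

Lemma phiB_periodic m l n (h : nat) x : phiB m l n (x - h%:R) = phiB m l n x.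
Proof.
rewrite /phiB; congr (_ + _ * _); apply: eq_bigr => k _; congr (_ * _).
rewrite -(cosDn2pi (_ * (x - _)) (k * h)); congr cos; rewrite natrM; ring.
Qed.

(** The odd [l] and the shift by [h] centre the sample points: offsets run from [- h] to [h], so for
    [|x| <= 1 / 2] every cosine has its argument in [[- pi / 2, pi / 2]]. *)
Lemma sum_cos_pow_phiB m h x : let l := (2 * h).+1 in
  \sum_(0 <= j < l) (cos (pi * (x + (j%:R - h%:R)) / l%:R) ^+ 2) ^+ m =
  l%:R * 'C(2 * m, m)%:R / 4 ^+ m * phiB m l m.+1 x.
Proof.
move=> l; have l0 : (0 < l)%N by [].
have := sum_cos_pow m (x - h%:R) l0; rewrite phiB_periodic => E.
rewrite -mulrA [4 ^- m * _]mulrC mulrA -E mulr_suml big_mkord.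
apply: eq_bigr => j _; rewrite -exprM.
have -> : (4 : R) ^+ m = 2 ^+ (2 * m) by rewrite exprM; congr (_ ^+ _); ring.
rewrite exprMn [RHS]mulrAC mulfV ?mul1r ?expf_neq0 //.
by congr (cos (_ / _) ^+ _); ring.
Qed.

Lemma centralbin_gt0 m (l : nat) : (0 < l)%N ->
  0 < l%:R * 'C(2 * m, m)%:R / 4 ^+ m :> R.
Proof. by move=> l0; rewrite divr_gt0 ?exprn_gt0 ?mulr_gt0 ?ltr0n ?bin_gt0 //; lia. Qed.

Lemma phiB_ge0 m h x : 0 <= phiB m (2 * h).+1 m.+1 x.
Proof.
have := centralbin_gt0 m (ltn0Sn (2 * h)) => c0.
rewrite -(pmulr_rge0 _ c0) -sum_cos_pow_phiB.
by apply: sumr_ge0 => j _; rewrite exprn_ge0 ?sqr_ge0.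
Qed.

(** The integer image nearest to [x] gives the first term; the images on each side are dominated by
    a geometric series of ratio [r]. *)
Definition theta_bound (a x : R) : R :=
  let r := expR (- (pi ^+ 2 / (4 * a))) in
  expR (- (pi ^+ 2 * x ^+ 2 / a)) + 2 * (r / (1 - r)).

Lemma theta_bound_ge0 (a x : R) : 0 < a -> 0 <= theta_bound a x.
Proof.
move=> a0; rewrite /theta_bound addr_ge0 ?expR_ge0 // mulr_ge0 // divr_ge0 ?expR_ge0 //.
by rewrite subr_ge0 expR_le1 oppr_le0 divr_ge0 ?sqr_ge0 // mulr_ge0 // ltW.
Qed.

(** For [m >= l^2 / a] the summand at offset [u] is at most [e^(- pi^2 u^2 m / l^2) <= e^(- pi^2 u^2
    / a)], a bound free of [l]. *)
Lemma phiB_le m h a x : 0 < a -> `|x| <= 1 / 2 ->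
  (2 * h).+1%:R ^+ 2 / a <= m%:R ->
  phiB m (2 * h).+1 m.+1 x <= theta_bound a x * phiB m (2 * h).+1 m.+1 0.
Proof.
move=> a0 x12 lm; set l := (2 * h).+1.
have lR : 0 < l%:R :> R by rewrite ltr0n.
have pi2 : 0 < pi ^+ 2 :> R by rewrite exprn_gt0 ?pi_gt0.
have := centralbin_gt0 m (ltn0Sn (2 * h)) => c0.
rewrite -(ler_pM2l c0) mulrCA -!sum_cos_pow_phiB.
set r := expR (- (pi ^+ 2 / (4 * a))).
have r0 : 0 <= r by exact: expR_ge0.
have r1 : r < 1 by rewrite /r expR_lt1 oppr_lt0 divr_gt0 // mulr_gt0.
have B0 := theta_bound_ge0 x a0.
(* At 0 the central summand is 1 and the others are nonnegative. *)
apply: (@le_trans _ _ (theta_bound a x)); last first.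
  rewrite ler_peMr //.
  rewrite (@big_cat_nat _ _ _ h) //=; last lia.
  rewrite [X in _ + X]big_ltn; last lia.
  rewrite subrr addr0 mulr0 mul0r cos0 !expr1n addrCA lerDl.
  by rewrite addr_ge0 // sumr_ge0 // => j _; rewrite exprn_ge0 ?sqr_ge0.
pose T (j : nat) := (cos (pi * (x + (j%:R - h%:R)) / l%:R) ^+ 2) ^+ m.
have Tle j : (j < l)%N -> T j <= expR (- (pi ^+ 2 * (x + (j%:R - h%:R)) ^+ 2 / a)).
  move=> jl; set u := x + _.
  have u2 : `|u| <= l%:R / 2.
    move: x12; rewrite /u /l !ler_norml -[(2 * h).+1%:R]natr1 natrM => x12.
    have j1 : (j%:R : R) <= 2 * h%:R by rewrite -natrM ler_nat; lia.
    have j0 : 0 <= (j%:R : R) by [].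
    by lra.
  have H := @cos_sqr_le_expR R (pi * u / l%:R).
  have {}H : cos (pi * u / l%:R) ^+ 2 <= expR (- (pi * u / l%:R) ^+ 2).
    apply: H; rewrite !normrM (ger0_norm (pi_ge0 R)) [`|_^-1|]gtr0_norm ?invr_gt0 //.
    by rewrite -mulrA ler_wpM2l ?pi_ge0 // ler_pdivrMr // mulrC.
  apply: le_trans (_ : expR (- (pi * u / l%:R) ^+ 2) ^+ m <= _).
    by rewrite lerXn2r ?nnegrE ?sqr_ge0 ?expR_ge0.
  rewrite -expRM_natr ler_expR mulNr lerN2.
  rewrite (_ : (pi * u / _) ^+ 2 * _ = pi ^+ 2 * u ^+ 2 * (m%:R / l%:R ^+ 2)); last first.
    by field; exact: lt0r_neq0.
  rewrite ler_wpM2l //; first exact: mulr_ge0 (sqr_ge0 _) (sqr_ge0 _).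
  rewrite ler_pdivlMr ?exprn_gt0 //.
  by rewrite mulrC.
(* With [|x| <= 1 / 2], an integer offset of size [n >= 1] leaves a distance at least [n - 1 / 2],
   and [(n - 1 / 2)^2 >= n / 4]: hence the 4 in [r]. *)
have Tr (j i : nat) : (j < l)%N -> (i.+1%:R = `|(j%:R - h%:R : R)|) -> T j <= r ^+ i.+1.
  move=> jl ij; apply: le_trans (Tle j jl) _.
  rewrite -expRM_natr ler_expR mulNr lerN2.
  have -> : pi ^+ 2 / (4 * a) * i.+1%:R = pi ^+ 2 * (i.+1%:R / 4) / a.
    by field; exact: lt0r_neq0.
  rewrite ler_pM2r ?invr_gt0 // ler_pM2l //.
  move: ij x12; rewrite ler_norml => ij /andP[x1 x2].
  have i1 : 1 <= (i.+1%:R : R) by rewrite ler1n.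
  have [d0|d0] := lerP 0 (j%:R - h%:R : R).
    by move: ij; rewrite ger0_norm // => <-; nra.
  move: ij; rewrite ltr0_norm // => ij.
  have -> : j%:R - h%:R = - i.+1%:R :> R by rewrite ij opprK.
  by nra.
rewrite -/T (@big_cat_nat _ _ _ h) //=; last lia.
rewrite [X in _ + X]big_ltn; last lia.
rewrite addrCA.
rewrite (_ : theta_bound a x = expR (- (pi ^+ 2 * x ^+ 2 / a)) + 2 * (r / (1 - r))) //.
rewrite lerD //.
  by have := Tle h; rewrite /T subrr addr0; apply; lia.
rewrite mulr_natl mulr2n lerD //.
  apply: le_trans (sum_expr_le h _); last by rewrite r0.
  rewrite big_nat_rev /= !big_nat; apply: ler_sum => i /andP[_ ih].
  apply: Tr; first lia.
  have i0 : 0 <= (i.+1%:R : R) by [].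
  by rewrite add0n natrB // ler0_norm; lra.
apply: le_trans (sum_expr_le h _); last by rewrite r0.
rewrite -{1}[h.+1]add0n big_addn (_ : l - h.+1 = h)%N; last by rewrite /l; lia.
rewrite !big_nat; apply: ler_sum => i /andP[_ ih].
apply: Tr; first by rewrite /l; lia.
by rewrite addnS -addSn natrD addrK ger0_norm.
Qed.

Lemma invr_odd_cvg : ((2 * h).+1%:R^-1 : R) @[h --> \oo] --> (0 : R).
Proof.
apply: (@squeeze_cvgr _ _ _ _ (fun=> 0) (@harmonic R)); [|exact: cvg_cst|exact: cvg_harmonic].
apply: nearW => h; rewrite invr_ge0 ler0n /= lef_pV2 ?posrE ?ltr0n // ler_nat; lia.
Qed.

(** Rounding up secures [m >= l^2 / a], as [phiB_le] demands, while [m / l^2] still tends to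
    [1 / a]. *)
Definition odd_trunc (a : R) (h : nat) : nat :=
  (Num.trunc ((2 * h).+1%:R ^+ 2 / a)).+1.

Lemma odd_trunc_bounds (a : R) h : 0 < a ->
  (2 * h).+1%:R ^+ 2 / a <= (odd_trunc a h)%:R <= (2 * h).+1%:R ^+ 2 / a + 1.
Proof.
move=> a0; have /truncn_itv/andP[t1 t2] : 0 <= (2 * h).+1%:R ^+ 2 / a.
  by rewrite divr_ge0 ?sqr_ge0 // ltW.
by rewrite /odd_trunc (ltW t2) /= -natr1 lerD2r.
Qed.

Lemma odd_trunc_div_cvg a : 0 < a ->
  ((odd_trunc a h)%:R / (2 * h).+1%:R ^+ 2 : R) @[h --> \oo] --> a^-1.
Proof.
move=> a0.
apply: (@squeeze_cvgr _ _ _ _ (fun=> a^-1) (fun h => a^-1 + (2 * h).+1%:R^-1 * (2 * h).+1%:R^-1)).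
- apply: nearW => h; have l0 : 0 < (2 * h).+1%:R ^+ 2 :> R by rewrite exprn_gt0 ?ltr0n.
  have l1 : (2 * h).+1%:R != 0 :> R by rewrite pnatr_eq0.
  have /andP[t1 t2] := odd_trunc_bounds h a0.
  rewrite ler_pdivlMr // ler_pdivrMr // mulrC t1 /= (le_trans t2) //.
  rewrite le_eqVlt; apply/orP; left; apply/eqP.
  by move: ((2 * h).+1%:R) l1 => l l1; field; rewrite l1 gt_eqF.
- exact: cvg_cst.
- rewrite -[X in _ --> X]addr0 -[X in _ --> _ + X](mulr0 0).
  by apply: cvgD; [exact: cvg_cst | apply: cvgM; exact: invr_odd_cvg].
Qed.

(** Squeeze: the two bounds on [binq] are the exponentials of [- (k l)^2 / (m + s k l)], that is of
    [- k^2 / (m / l^2 + s k / l)], for [s = 1] and [s = -1]. *)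
Lemma binq_cvg a k : 0 < a ->
  binq R (odd_trunc a h) (k * (2 * h).+1) @[h --> \oo] --> expR (- (a * k%:R ^+ 2)).
Proof.
move=> a0; have av : a^-1 != 0 by rewrite invr_eq0 gt_eqF.
pose w (s : R) (h : nat) := k%:R ^+ 2 / ((odd_trunc a h)%:R / (2 * h).+1%:R ^+ 2
   + s * k%:R * (2 * h).+1%:R^-1).
have wcvg s : expR (- w s h) @[h --> \oo] --> expR (- (a * k%:R ^+ 2)).
  apply: continuous_cvg; first exact: continuous_expR.
  apply: cvgN; rewrite mulrC; apply: cvgM; first exact: cvg_cst.
  rewrite -[X in _ --> X]invrK; apply: cvgV => //.
  rewrite -[X in _ --> X]addr0 -[X in _ --> _ + X](mulr0 (s * k%:R)).
  apply: cvgD; first exact: odd_trunc_div_cvg.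
  by apply: cvgM; [exact: cvg_cst | exact: invr_odd_cvg].
apply: (@squeeze_cvgr _ _ _ _ (fun h => expR (- w (-1) h)) (fun h => expR (- w 1 h)));
  [|exact: wcvg|exact: wcvg].
near=> h.
have l0 : 0 < (2 * h).+1%:R :> R by rewrite ltr0n.
have /andP[t1 t2] := odd_trunc_bounds h a0.
(* The lower bound needs [k l < m]; since [m >= l^2 / a], this holds once [h > k a]. *)
have klm : (k * (2 * h).+1 < odd_trunc a h)%N.
  rewrite -(ltr_nat R); apply: lt_le_trans t1.
  rewrite ltr_pdivlMr // natrM expr2 mulrAC ltr_pM2r //.
  apply: (@lt_le_trans _ _ h%:R); last by rewrite ler_nat; lia.
  near: h; exact: nbhs_infty_gtr.
set m := odd_trunc a h in t1 t2 klm *; set l := (2 * h).+1 in l0 t1 t2 klm *.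
have l1 : l%:R != 0 :> R by rewrite gt_eqF.
have klR : (k * l)%:R < m%:R :> R by rewrite ltr_nat.
have kl0 : 0 <= (k * l)%:R :> R by [].
have E1 : w (-1) h = (k * l)%:R ^+ 2 / (m - k * l)%:R.
  rewrite /w natrB 1?ltnW // natrM -/m -/l.
  have : m%:R - k%:R * l%:R != 0 :> R by rewrite -natrM subr_eq0 gt_eqF.
  move: (l%:R) l1 (m%:R) (k%:R) => L L1 Mm k' nz; field; rewrite ?L1 ?nz //=.
have E2 : w 1 h = (k * l)%:R ^+ 2 / (m + k * l)%:R.
  rewrite /w natrD natrM -/m -/l.
  have : m%:R + k%:R * l%:R != 0 :> R by rewrite -natrM gt_eqF //; lra.
  by move: (l%:R) l1 (m%:R) (k%:R) => L L1 Mm k' nz; field; rewrite L1 nz.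
by rewrite E1 E2 binq_ge_expR // binq_le_expR //; lia.
Unshelve. all: end_near. Qed.

Definition phiK (a : R) (K : nat) x : R :=
  1 + 2 * \sum_(1 <= k < K.+1) expR (- (a * k%:R ^+ 2)) * cos (2 * pi * k%:R * x).

Lemma phiB_cvg a K x : 0 < a ->
  phiB (odd_trunc a h) (2 * h).+1 K.+1 x @[h --> \oo] --> phiK a K x.
Proof.
move=> a0; apply: cvgD; first exact: cvg_cst.
apply: cvgM; first exact: cvg_cst.
elim: K => [|K IH].
  by under eq_cvg do rewrite big_geq //; rewrite big_geq //; exact: cvg_cst.
under eq_cvg do rewrite big_nat_recr //=.
rewrite big_nat_recr //=; apply: cvgD; first exact: IH.
by apply: cvgM; [exact: binq_cvg | exact: cvg_cst].
Qed.

(* By [binqD] the modes beyond K carry at most the fraction c of the full sum. *)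
Lemma phiB_trunc m h K x : (K <= m)%N ->
  let l := (2 * h).+1 in let c := binq R m (K * l) in
  [/\ - (c * phiB m l K.+1 0) <= (1 - c) * phiB m l K.+1 x &
     forall B, 0 <= B -> phiB m l m.+1 x <= B * phiB m l m.+1 0 ->
       (1 - c) * phiB m l K.+1 x <= (B + c) * phiB m l K.+1 0].
Proof.
move=> Km l c.
have c0 : 0 <= c by exact: binq_ge0.
have c1 : 0 <= 1 - c by rewrite subr_ge0 binq_le1.
pose T y : R := 2 * \sum_(K.+1 <= k < m.+1) binq R m (k * l) * cos (2 * pi * k%:R * y).
have fE y : phiB m l m.+1 y = phiB m l K.+1 y + T y.
  by rewrite /phiB /T (@big_cat_nat _ _ _ K.+1) //= mulrDr addrA.
have T0E : T 0 = 2 * \sum_(K.+1 <= k < m.+1) binq R m (k * l).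
  by rewrite /T; congr (_ * _); apply: eq_bigr => k _; rewrite mulr0 cos0 mulr1.
have Tle : `|T x| <= T 0.
  rewrite T0E normrM ger0_norm // ler_wpM2l //.
  apply: le_trans (ler_norm_sum _ _ _) _; apply: ler_sum => k _.
  by rewrite normrM ger0_norm ?binq_ge0 // ler_piMr ?binq_ge0 ?cos_max.
have Tc : T 0 <= c * phiB m l m.+1 0.
  apply: (@le_trans _ _ (c * (2 * \sum_(1 <= k < m.+1) binq R m (k * l)))); last first.
    rewrite ler_wpM2l // /phiB.
    rewrite (eq_bigr (fun k => binq R m (k * l) * cos (2 * pi * k%:R * 0))).
      by rewrite lerDr.
    by move=> k _; rewrite mulr0 cos0 mulr1.
  rewrite T0E mulrCA ler_wpM2l // mulr_sumr.
  rewrite [X in _ <= X](@big_cat_nat _ _ _ (m - K).+1) //=; last lia.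
  rewrite -[X in X <= _]addr0 lerD //; last first.
    by apply: sumr_ge0 => k _; rewrite mulr_ge0 ?binq_ge0.
  rewrite -{1}[K.+1]add1n big_addn (_ : m.+1 - K = (m - K).+1)%N; last lia.
  by apply: ler_sum => k _; rewrite mulnDl addnC binqD.
have f0 : phiB m l m.+1 0 = phiB m l K.+1 0 + T 0 by [].
have fx : phiB m l m.+1 x = phiB m l K.+1 x + T x by [].
have fpos : 0 <= phiB m l m.+1 x by exact: phiB_ge0.
move: Tle; rewrite ler_norml => /andP[T1 T2].
have c1' : c <= 1 by rewrite -subr_ge0.
move: f0 fx fpos Tc; move: (phiB m l m.+1 0) (phiB m l m.+1 x) => F0 Fx.
move: (phiB m l K.+1 0) (phiB m l K.+1 x) T1 T2; move: (T 0) (T x) => T0 Tx P0 Px.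
move=> T1 T2 f0 fx fpos Tc.
have Q1 : (1 - c) * T0 <= c * P0 by rewrite f0 in Tc; lra.
have Q2 : (1 - c) * (- T0) <= (1 - c) * Px by rewrite ler_wpM2l //; lra.
split; first by lra.
move=> B B0 FB.
have Q3 : (1 - c) * Px <= (1 - c) * (B * F0 + T0) by rewrite ler_wpM2l //; lra.
have Q4 : B * ((1 - c) * F0) <= B * P0 by rewrite ler_wpM2l //; rewrite f0; lra.
by lra.
Qed.

(** Both inequalities of [phiB_trunc] involve finitely many modes and no division by [1 - c], so
    they pass to the limit, where [c] becomes [d]. *)
Lemma phiK_bounds a K x : 0 < a -> let d := expR (- (a * K%:R ^+ 2)) in
  (- (d * phiK a K 0) <= (1 - d) * phiK a K x) /\
  (`|x| <= 1 / 2 -> (1 - d) * phiK a K x <= (theta_bound a x + d) * phiK a K 0).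
Proof.
move=> a0 d.
have Kle : \forall h \near \oo, (K <= odd_trunc a h)%N.
  near=> h; rewrite -(ler_nat R).
  have /andP[t1 _] := odd_trunc_bounds h a0; apply: le_trans t1.
  rewrite ler_pdivlMr // expr2.
  apply: (@le_trans _ _ ((2 * h).+1%:R * 1)); last first.
    by rewrite ler_wpM2l // ler1n.
  rewrite mulr1; apply: (@le_trans _ _ h%:R); last by rewrite ler_nat; lia.
  near: h; exact: nbhs_infty_ger.
have cc : 1 - binq R (odd_trunc a h) (K * (2 * h).+1) @[h --> \oo] --> 1 - d.
  by apply: cvgB; [exact: cvg_cst | exact: binq_cvg].
have H0 : binq R (odd_trunc a h) (K * (2 * h).+1) @[h --> \oo] --> d := binq_cvg a0.
have H1 y := @phiB_cvg a K y a0.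
split.
  have G1 := cvgN (cvgM H0 (H1 0)); have G2 := cvgM cc (H1 x).
  apply: (ler_cvg_to (G1 _ _) (G2 _)).
  near=> h; have Km : (K <= odd_trunc a h)%N by near: h.
  by case: (phiB_trunc h x Km).
move=> x12; have G1 := cvgM cc (H1 x).
have G2 := cvgM (cvgD (cvg_cst (theta_bound a x)) H0) (H1 0).
apply: (ler_cvg_to (G1 _) (G2 _ _ _)).
near=> h; have Km : (K <= odd_trunc a h)%N by near: h.
case: (phiB_trunc h x Km) => _; apply; first exact: theta_bound_ge0.
by apply: phiB_le => //; have /andP[] := odd_trunc_bounds h a0.
Unshelve. all: end_near. Qed.

End Theta.

(** * The filtered signal *)

Section Cmod.
Variable R : realType.
Implicit Types z u : R[i].

Lemma cmodE z : (cmod z)%:C%C = `|z|.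
Proof. by rewrite normc_def. Qed.

Lemma sqr_cmod z : cmod z ^+ 2 = complex.Re z ^+ 2 + complex.Im z ^+ 2.
Proof. by rewrite sqr_sqrtr // addr_ge0 ?sqr_ge0. Qed.

Lemma cmodD z u : cmod (z + u) <= cmod z + cmod u.
Proof. by rewrite -lecR rmorphD /= !cmodE ler_normD. Qed.

Lemma cmodN z : cmod (- z) = cmod z.
Proof. by apply: complexI; rewrite !cmodE normrN. Qed.

Lemma cmodM z u : cmod (z * u) = cmod z * cmod u.
Proof. by apply: complexI; rewrite rmorphM /= !cmodE normrM. Qed.

Lemma cmod_sum (I : Type) (r : seq I) (P : pred I) (F : I -> R[i]) :
  cmod (\sum_(i <- r | P i) F i) <= \sum_(i <- r | P i) cmod (F i).
Proof.
elim/big_rec2: _ => [|i x z _ le]; first by rewrite /cmod expr0n /= addr0 sqrtr0.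
by apply: le_trans (cmodD _ _) _; rewrite lerD2l.
Qed.

Lemma cmod_creal (x : R) : cmod (creal x) = `|x|.
Proof. by rewrite /cmod /= expr0n addr0 sqrtr_sqr. Qed.

Lemma cmod_expi (x : R) : cmod (expi x) = 1.
Proof. by rewrite /cmod /= cos2Dsin2 sqrtr1. Qed.

Lemma cconjB z u : cconj (z - u) = cconj z - cconj u.
Proof. by case: z u => [a b] [c d]; rewrite /cconj /=; simpc; congr Complex; ring. Qed.

Lemma cmod_cconj z : cmod (cconj z) = cmod z.
Proof. by rewrite /cmod /= sqrrN. Qed.

Lemma ler_Re_cmod z : complex.Re z <= cmod z.
Proof.
apply: le_trans (ler_norm _) _; rewrite -sqrtr_sqr ler_wsqrtr //.
by rewrite lerDl sqr_ge0.
Qed.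

Lemma cconj_expi (x : R) : cconj (expi x) = expi (- x).
Proof. by rewrite /cconj /expi cosN sinN. Qed.

Lemma continuous_bigsum (I : Type) (r : seq I) (f : I -> R -> R) :
  (forall i, continuous (f i)) -> continuous (fun x => \sum_(i <- r) f i x).
Proof.
move=> cf; elim: r => [|i r IH] x.
  have -> : (fun y => \sum_(i <- [::]) f i y) = (fun=> 0).
    by apply/funext => y; rewrite big_nil.
  exact: cvg_cst.
have -> : (fun y => \sum_(j <- i :: r) f j y) = (fun y => f i y + \sum_(j <- r) f j y).
  by apply/funext => y; rewrite big_cons.
by apply: cvgD; [exact: cf | exact: IH].
Qed.

Lemma Im_sum (I : Type) (r : seq I) (P : pred I) (F : I -> R[i]) :
  complex.Im (\sum_(i <- r | P i) F i) = \sum_(i <- r | P i) complex.Im (F i).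
Proof. by apply: (big_morph (@complex.Im R)) => // -[a b] [c d]. Qed.

Lemma continuous_cmod_trig (I : Type) (r : seq I) (c : I -> R[i]) (f : I -> R) :
  continuous (fun x => cmod (\sum_(i <- r) c i * expi (f i * x))).
Proof.
have cl (b : R) : continuous (fun x : R => b * x).
  by move=> x; apply: cvgM; [exact: cvg_cst | exact: cvg_id].
have cc (b : R) : continuous (fun x : R => cos (b * x)).
  by move=> x; apply: continuous_comp; [exact: cl | exact: continuous_cos].
have cs (b : R) : continuous (fun x : R => sin (b * x)).
  by move=> x; apply: continuous_comp; [exact: cl | exact: continuous_sin].
have cRe : continuous (fun x => complex.Re (\sum_(i <- r) c i * expi (f i * x))).
  under eq_fun do rewrite Re_sum.
  apply: continuous_bigsum => i x; case: (c i) => a b /=.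
  by apply: cvgB; apply: cvgM; [exact: cvg_cst|exact: cc|exact: cvg_cst|exact: cs].
have cIm : continuous (fun x => complex.Im (\sum_(i <- r) c i * expi (f i * x))).
  under eq_fun do rewrite Im_sum.
  apply: continuous_bigsum => i x; case: (c i) => a b /=.
  by apply: cvgD; apply: cvgM; [exact: cvg_cst|exact: cs|exact: cvg_cst|exact: cc].
move=> x; rewrite /cmod.
apply: (@continuous_comp _ _ _ (fun x : R => complex.Re (\sum_(i <- r) c i * expi (f i * x)) ^+ 2 +
  complex.Im (\sum_(i <- r) c i * expi (f i * x)) ^+ 2) Num.sqrt); last exact: sqrt_continuous.
by apply: cvgD; under eq_fun do rewrite expr2; rewrite expr2; apply: cvgM; (exact: cRe || exact: cIm).
Qed.

End Cmod.

(** * The Gaussian filter and its normalisation *)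

Section Phis.
Variable R : realType.
Variables (K : nat) (tau : R).

Definition width : R := pi * tau / K%:R ^+ 2.

Lemma phihatE (k : int) : 0 <= tau ->
  phihat K tau k = expR (- (width * k%:~R ^+ 2)).
Proof.
move=> t0; rewrite /phihat /width; congr (expR (- _)).
rewrite !exprMn sqr_sqrtr // exprVn; ring.
Qed.

Lemma width_gt0 : (0 < K)%N -> 0 < tau -> 0 < width.
Proof. by move=> K0 t0; rewrite divr_gt0 ?exprn_gt0 ?mulr_gt0 ?pi_gt0 ?ltr0n. Qed.

Lemma expR_widthK : (0 < K)%N -> expR (- (width * K%:R ^+ 2)) = expR (- (pi * tau)).
Proof.
move=> K0; rewrite /width; congr (expR (- _)); field.
by rewrite pnatr_eq0 -lt0n.
Qed.

(* (K + j)^2 >= K^2 + j^2, so the tail beyond K is at most e^(- pi tau) times the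
   whole series. *)
Lemma phis_bounds : (0 < K)%N -> 0 < tau ->
  phiK width K 0 <= phis K tau /\
  (1 - expR (- (pi * tau))) * phis K tau <= phiK width K 0.
Proof.
move=> K0 t0; have w0 := width_gt0 K0 t0.
rewrite -expR_widthK //; set a := width; set d := expR (- (a * K%:R ^+ 2)).
have d0 : 0 <= d by exact: expR_ge0.
have d1 : d < 1 by rewrite /d expR_lt1 oppr_lt0 mulr_gt0 ?exprn_gt0 ?ltr0n.
pose e (k : nat) : R := expR (- (a * k.+1%:R ^+ 2)).
have e0 k : 0 <= e k by exact: expR_ge0.
have -> : phis K tau = 1 + 2 * limn (series e).
  rewrite /phis phihatE ?ltW // mulr0z expr0n mulr0 oppr0 expR0.
  have -> // : (fun k : nat => phihat K tau k.+1%:Z) = e.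
  by apply/funext => k; rewrite phihatE ?ltW // -pmulrn.
have -> : phiK a K 0 = 1 + 2 * series e K.
  rewrite /phiK /series /= big_add1 /=; congr (_ + _ * _).
  by apply: eq_bigr => k _; rewrite mulr0 cos0 mulr1.
have Sge0 N : 0 <= series e N by rewrite /series /= sumr_ge0.
have nd : nondecreasing_seq (series e).
  apply/nondecreasing_seqP => n; rewrite /series /= big_nat_recr //=; rewrite lerDl //.
have SN N : (1 - d) * series e N <= series e K.
  have [NK|KN] := leqP N K.
    by apply: le_trans (nd _ _ NK); rewrite ler_piMl // gerBl.
  have : series e N <= series e K + d * series e N.
    have {1}-> : series e N = series e K + \sum_(K <= k < N) e k.
      by rewrite /series /= (@big_cat_nat _ _ _ K) 1?ltnW.
    rewrite lerD2l; apply: (@le_trans _ _ (d * series e (N - K)%N)); last first.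
      by rewrite ler_wpM2l // nd // leq_subr.
    rewrite /series /= mulr_sumr -{1}[K]add0n big_addn.
    apply: ler_sum => j _; rewrite /e /d -expRD ler_expR -opprD lerN2 -mulrDr ler_wpM2l ?(ltW w0) //.
    rewrite -addSn natrD; have : 0 <= j.+1%:R * K%:R :> R by rewrite mulr_ge0.
    by move: (j.+1%:R) (K%:R) => p q pq; rewrite sqrrD; lra.
  lra.
have d1' : 0 < 1 - d by rewrite subr_gt0.
(* [limn] is meaningful only for a convergent sequence; [SN] and monotonicity give the
   convergence. *)
have ub : has_ubound (range (series e)).
  exists (series e K / (1 - d)) => _ [N _ <-].
  by rewrite ler_pdivlMr // mulrC.
have cv := nondecreasing_is_cvgn nd ub.
split; first by rewrite lerD2l ler_wpM2l // nondecreasing_cvgn_le.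
have : limn (series e) <= series e K / (1 - d).
  apply: limr_le => //; apply: nearW => N.
  by rewrite ler_pdivlMr // mulrC.
rewrite ler_pdivlMr // => L.
lra.
Qed.

Lemma phiK_periodic a (z : int) (x : R) : phiK a K (x - z%:~R) = phiK a K x.
Proof.
rewrite /phiK; congr (_ + _ * _); apply: eq_bigr => k _; congr (_ * _).
rewrite -(cosDz2pi (_ * (x - _)) (k%:Z * z)); congr cos.
by rewrite intrM -pmulrn; ring.
Qed.

Lemma phiK_norm a (x : R) : `|phiK a K x| <= phiK a K 0.
Proof.
apply: le_trans (ler_normD _ _) _; rewrite normr1 lerD2l normrM ger0_norm // ler_wpM2l //.
apply: le_trans (ler_norm_sum _ _ _) _; apply: ler_sum => k _.
by rewrite mulr0 cos0 normrM ger0_norm ?expR_ge0 // ler_wpM2l ?expR_ge0 ?cos_max.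
Qed.

(** The lower bound of [phiK_bounds] is [- d / (1 - d)] times the peak, and [d <= 1 / 12] gives
    [1 / (1 - d) <= 12 / 11]. *)
Lemma phiK_ge (x : R) : (0 < K)%N -> 0 < tau -> expR (- (pi * tau)) <= 1 / 12 ->
  - (12 / 11 * expR (- (pi * tau)) * phis K tau) <= phiK width K x.
Proof.
move=> K0 t0 d12; have w0 := width_gt0 K0 t0.
have [P1 P2] := phis_bounds K0 t0.
have [L _] := phiK_bounds K x w0.
rewrite /= expR_widthK // in L.
have d0 : 0 <= expR (- (pi * tau)) by exact: expR_ge0.
have D0 : 0 <= phiK width K 0 by apply: le_trans (phiK_norm _ 0).
move: (expR _) d0 d12 P2 L => d d0 d12 P2 L.
have Q : d * phiK width K 0 <= d * phis K tau by rewrite ler_wpM2l.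
by nra.
Qed.

(** With [d = e^(- pi tau)], the nearest image contributes at most [d], the other images together
    [d / 3] (as [r <= d^2 <= d / 12]) and the truncation [d]. Dividing [7 d / 3] by
    [1 - d >= 11 / 12] gives [28 d / 11]. *)
Lemma phiK_far (x : R) : (0 < K)%N -> 0 < tau -> expR (- (pi * tau)) <= 1 / 12 ->
  24 * tau <= K%:R -> (forall z : int, tau / K%:R <= `|x - z%:~R|) ->
  `|phiK width K x| <= 28 / 11 * expR (- (pi * tau)) * phis K tau.
Proof.
move=> K0 t0 d12 K24 far; have w0 := width_gt0 K0 t0.
have KR : 0 < K%:R :> R by rewrite ltr0n.
have [P1 P2] := phis_bounds K0 t0.
have D0 : 0 <= phiK width K 0 by apply: le_trans (phiK_norm _ 0).
have d0 : 0 <= expR (- (pi * tau)) by exact: expR_ge0.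
have L := phiK_ge x K0 t0 d12.
have Ph0 : 0 <= phis K tau by apply: le_trans P1.
rewrite ler_norml; apply/andP; split.
  by apply: le_trans L; rewrite lerN2 ler_wpM2r // ler_wpM2r //; lra.
pose z := Num.floor (x + 1 / 2).
have {}far := far z.
rewrite -(phiK_periodic _ z); set u := x - z%:~R in far *.
have u12 : `|u| <= 1 / 2.
  have := floor_itv (x + 1 / 2); rewrite -/z intrD => /andP[z1 z2].
  by rewrite ler_norml /u; lra.
have [_ /(_ u12)] := phiK_bounds K u w0; rewrite /= expR_widthK //.
suff B : theta_bound width u <= 4 / 3 * expR (- (pi * tau)).
  move: (expR _) d0 d12 P2 L B => d d0 d12 P2 L B U.
  have Q : (theta_bound width u + d) * phiK width K 0 <= (7 / 3 * d) * phis K tau.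
    by apply: ler_pM => //; [rewrite addr_ge0 ?theta_bound_ge0 | lra].
  have dP : 0 <= d * phis K tau by rewrite mulr_ge0.
  have := le_trans U Q; nra.
have pi0 := pi_gt0 R.
have [piN KN tN] : [/\ pi != 0 :> R, K%:R != 0 :> R & tau != 0] by rewrite !gt_eqF.
rewrite /theta_bound /=; set d := expR (- (pi * tau)) in d0 d12 *.
have E1 : expR (- (pi ^+ 2 * u ^+ 2 / width)) <= d.
  rewrite ler_expR lerN2 /width.
  have -> : pi ^+ 2 * u ^+ 2 / (pi * tau / K%:R ^+ 2) = pi * ((`|u| * K%:R) ^+ 2 / tau).
    rewrite exprMn real_normK ?num_real //.
    by move: (@pi R) piN => p pN; field; rewrite pN KN tN.
  rewrite (ler_pM2l pi0) ler_pdivlMr // -expr2 lerXn2r ?nnegrE ?mulr_ge0 ?(ltW t0) ?(ltW KR) //.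
  by rewrite -ler_pdivrMr.
have E2 : expR (- (pi ^+ 2 / (4 * width))) <= d ^+ 2.
  rewrite /d -expRM_natr ler_expR mulNr lerN2 /width.
  have -> : pi ^+ 2 / (4 * (pi * tau / K%:R ^+ 2)) = pi * (K%:R ^+ 2 / (4 * tau)).
    by move: (@pi R) piN => p pN; field; rewrite pN KN tN.
  rewrite -mulrA (ler_pM2l pi0) ler_pdivlMr ?mulr_gt0 //.
  by nra.
move: (expR (- (pi ^+ 2 / (4 * width)))) E2 (expR_ge0 (- (pi ^+ 2 / (4 * width)))) => r E2 r0.
have dd : d ^+ 2 <= d / 12 by rewrite expr2; nra.
have r1 : 0 < 1 - r by lra.
have E3 : r / (1 - r) <= d / 6 by rewrite ler_pdivrMr //; nra.
by lra.
Qed.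

End Phis.

(** * The noisy signal on the lattice and away from it *)

Section Signal.
Variable R : realType.

Lemma sum_symmetric (V : nmodType) (f : int -> V) (K : nat) :
  \sum_(i < (2 * K).+1) f (i%:Z - K%:Z) =
  f 0 + \sum_(1 <= k < K.+1) (f k%:Z + f (- k%:Z)).
Proof.
rewrite -(big_mkord xpredT (fun i : nat => f (i%:Z - K%:Z))).
rewrite (@big_cat_nat _ _ _ K) //=; last lia.
rewrite [X in _ + X]big_ltn; last lia.
rewrite subrr addrCA; congr (_ + _); rewrite big_split /= addrC; congr (_ + _).
  rewrite -[K.+1]addn1 addnC -{1}[(1 + K)%N]/(K.+1) -{1}[K.+1]add0n.
  rewrite big_addn [RHS]big_add1 /= (_ : (2 * K).+1 - K.+1 = K)%N; last lia.
  by apply: eq_bigr => i _; congr f; lia.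
rewrite big_nat_rev /= [RHS]big_add1 /= !big_nat.
by apply: eq_bigr => i /andP[_ iK]; congr f; lia.
Qed.

Variables (I : finType) (w nu : I -> R).

Definition spectral_mean (t : R) : R[i] :=
  \sum_i creal (w i) * expi (- (2 * pi * nu i * t)).

Lemma cconj_sum (J : Type) (r : seq J) (F : J -> R[i]) :
  cconj (\sum_(i <- r) F i) = \sum_(i <- r) cconj (F i).
Proof.
apply: (big_morph (@cconj R)); last by rewrite /cconj /= oppr0.
by move=> [a b] [c d]; rewrite /cconj /=; simpc; congr Complex; ring.
Qed.

Lemma yfull_spectral (M : R) (k : int) :
  yfull (fun j : nat => spectral_mean (M * j%:R)) k = spectral_mean (M * k%:~R).
Proof.
rewrite /yfull; case: ifPn => k0; first by rewrite pmulrn gez0_abs.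
rewrite /spectral_mean cconj_sum; apply: eq_bigr => i _.
have kE : k%:~R = - (`|k|%N)%:R :> R.
  by rewrite pmulrn lez0_abs ?mulrNz ?opprK //; move: k0; rewrite -ltNge => /ltW.
rewrite kE; set x := 2 * pi * nu i.
have -> : - (x * (M * - `|k|%N%:R)) = - (- (x * (M * `|k|%N%:R))) by ring.
rewrite -(cconj_expi (- _)) /cconj /creal /=.
by congr Complex; ring.
Qed.

Lemma sum_phihat_expi (K : nat) (tau u : R) : 0 <= tau ->
  \sum_(i < (2 * K).+1) (let k := (i%:Z - K%:Z)%R in
     creal (phihat K tau k) * expi (2 * pi * k%:~R * u)) = creal (phiK (width K tau) K u).
Proof.
move=> t0.
rewrite (sum_symmetric (fun k : int => creal (phihat K tau k) * expi (2 * pi * k%:~R * u)) K).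
have crealD (a b : R) : creal (a + b) = creal a + creal b.
  by rewrite /creal; simpc.
rewrite /phiK crealD; congr (_ + _).
  rewrite phihatE // mulr0z expr0n !mulr0 mul0r oppr0 expR0 expi0 mulr1 //.
rewrite mulr_sumr (big_morph (@creal R) crealD (erefl _)).
apply: eq_bigr => k _; rewrite !phihatE // mulrNz sqrrN -pmulrn.
rewrite mulrN mulNr /creal /expi cosN sinN; simpc.
by congr Complex; ring.
Qed.

Lemma Fsig_exact (K : nat) (tau M x : R) : 0 <= tau ->
  Fsig K tau (fun j : nat => spectral_mean (M * j%:R)) x =
  creal (\sum_i w i * phiK (width K tau) K (x - M * nu i)).
Proof.
move=> t0.
have crealD (a b : R) : creal (a + b) = creal a + creal b.
  by rewrite /creal; simpc.
have crealM (a b : R) : creal (a * b) = creal a * creal b.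
  by rewrite /creal; simpc.
rewrite (big_morph (@creal R) crealD (erefl _)) /Fsig.
under [RHS]eq_bigr do rewrite crealM -sum_phihat_expi // mulr_sumr.
rewrite exchange_big /=; apply: eq_bigr => j _.
rewrite yfull_spectral /spectral_mean -mulrA mulr_suml.
apply: eq_bigr => i _; set k := (j%:Z - K%:Z)%R.
rewrite -mulrA; congr (_ * _); rewrite mulrCA -expiD; congr (_ * expi _).
ring.
Qed.

(** The weights [phihat k] are positive and add up over [|k| <= K] to the peak of the filter, so an
    error [alpha] in each average costs at most [alpha] times the peak. *)
Lemma Fsig_noise (K : nat) (tau alpha x : R) (y y' : nat -> R[i]) : 0 <= tau ->
  (forall k, (k <= K)%N -> cmod (y k - y' k) <= alpha) ->
  cmod (Fsig K tau y x - Fsig K tau y' x) <= alpha * phiK (width K tau) K 0.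
Proof.
move=> t0 yy.
have -> : phiK (width K tau) K 0 = \sum_(i < (2 * K).+1) phihat K tau (i%:Z - K%:Z).
  rewrite (sum_symmetric (phihat K tau) K) phihatE // mulr0z expr0n mulr0 oppr0 expR0.
  rewrite /phiK mulr_sumr; congr (_ + _); apply: eq_bigr => k _.
  by rewrite !phihatE // mulrNz sqrrN -pmulrn mulr0 cos0; ring.
rewrite /Fsig -sumrB mulr_sumr; apply: le_trans (cmod_sum _ _ _) _.
apply: ler_sum => i _; set k := (i%:Z - K%:Z)%R.
rewrite -!mulrA -mulrBl !cmodM cmod_expi mulr1 cmod_creal ger0_norm ?expR_ge0 //.
rewrite ler_wpM2r ?expR_ge0 //.
have kK : (`|k| <= K)%N by rewrite /k; have := ltn_ord i; lia.
rewrite /yfull; case: ifP => _; first exact: yy.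
by rewrite -cconjB cmod_cconj yy.
Qed.

Variables (A : pred I) (beta omega alpha : R) (K : nat) (M : R) (y : nat -> R[i]).
Let tau := tau_of beta omega.

(** [A] marks the atoms of the wanted eigenvalues; of the others only the total mass is known, and
    their frequencies are arbitrary. *)
Definition signal_hyp : Prop :=
  [/\ forall i, 0 <= w i, \sum_i w i = 1, forall i, A i -> beta <= w i,
      \sum_(i | ~~ A i) w i <= omega & exists i, A i] /\
  [/\ 0 < alpha < (beta - omega) / 3, omega < beta, 24 * tau <= K%:R &
      forall k, (k <= K)%N -> cmod (y k - spectral_mean (M * k%:R)) <= alpha].

Lemma signal_params : signal_hyp ->
  [/\ 0 <= omega, beta <= 1, 0 < tau, (0 < K)%N & expR (- (pi * tau)) = (beta - omega) / 12].
Proof.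
move=> [[w0 w1 wb wo [i0 Ai0]] [a0 ob K24 _]].
have om0 : 0 <= omega by apply: le_trans wo; apply: sumr_ge0.
have b1 : beta <= 1.
  apply: le_trans (wb _ Ai0) _; rewrite -w1 (bigD1 i0) //= lerDl.
  by apply: sumr_ge0.
have bo : 0 < beta - omega by rewrite subr_gt0.
have pi0 := pi_gt0 R.
have t0 : 0 < tau.
  rewrite /tau /tau_of mulr_gt0 ?divr_gt0 // ln_gt0 // ltr_pdivlMr //; lra.
have K0 : (0 < K)%N.
  by rewrite -(ltr_nat R); apply: lt_le_trans K24; rewrite mulr_gt0.
split=> //; rewrite /tau /tau_of div1r mulrA mulfV ?gt_eqF // mul1r expRN.
by rewrite lnK ?posrE ?divr_gt0 // invf_div.
Qed.

Let thr := (6 * beta + 5 * omega) / 11 * phis K tau.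

Lemma phis_gt0 : (0 < K)%N -> 0 < tau -> 0 < phis K tau.
Proof.
move=> K0 t0; have [P1 _] := phis_bounds K0 t0; apply: lt_le_trans P1.
rewrite /phiK ltr_wpDr // mulr_ge0 // sumr_ge0 // => k _.
by rewrite mulr0 cos0 mulr1 expR_ge0.
Qed.

(** In units of [phis] and with [d = (beta - omega) / 12], the atom [i] gives at least
    [w i (1 - d)], the others at least [- (1 - w i) 12 d / 11], and the noise takes at most [alpha].
    The total exceeds [beta - 14 (beta - omega) / 33], and the threshold is
    [beta - 15 (beta - omega) / 33]. *)
Lemma signal_near i (z : int) : signal_hyp -> A i -> thr < cmod (Fsig K tau y (M * nu i + z%:~R)).
Proof.
move=> H Ai; have [om0 b1 t0 K0 dE] := signal_params H.
case: H => [[w0 w1 wb wo _] [/andP[a0 a1] ob K24 yy]].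
set x := M * nu i + z%:~R.
have P0 := phis_gt0 K0 t0.
have [P1 P2] := phis_bounds K0 t0.
have Nz := @Fsig_noise K tau alpha x y _ (ltW t0) yy.
have d12 : expR (- (pi * tau)) <= 1 / 12 by rewrite dE; lra.
pose G := \sum_i w i * phiK (width K tau) K (x - M * nu i).
have Gc : G - alpha * phiK (width K tau) K 0 <= cmod (Fsig K tau y x).
  rewrite (Fsig_exact _ _ _ (ltW t0)) -/G in Nz.
  have : G <= cmod (creal G) by exact: (ler_Re_cmod (creal G)).
  have := cmodD (Fsig K tau y x) (- (Fsig K tau y x - creal G)).
  rewrite cmodN opprB addrC subrK => T1 T2.
  by rewrite lerBlDr (le_trans T2) // (le_trans T1) // lerD2l.
have Gl : w i * phiK (width K tau) K 0 -
    (1 - w i) * (12 / 11 * expR (- (pi * tau)) * phis K tau) <= G.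
  rewrite /G (bigD1 i) //= {1}/x addrAC subrr add0r.
  rewrite -[in X in _ <= X + _](phiK_periodic K _ z) subrr.
  have -> : 1 - w i = \sum_(j | j != i) w j.
    by rewrite -w1 (bigD1 i) //= addrAC subrr add0r.
  rewrite lerD2l -[leLHS]mulrN mulr_suml.
  apply: ler_sum => j _; rewrite ler_wpM2l //.
  exact: (phiK_ge _ K0 t0 d12).
apply: lt_le_trans Gc.
apply: lt_le_trans (_ : _ < w i * phiK (width K tau) K 0 -
  (1 - w i) * (12 / 11 * expR (- (pi * tau)) * phis K tau) -
  alpha * phis K tau) _; last first.
  by apply: lerB => //; rewrite ler_wpM2l // ltW.
have := wb _ Ai; have wi0 := w0 i.
have wi1 : w i <= 1 by rewrite -w1 (bigD1 i) //= lerDl sumr_ge0.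
rewrite /thr; move: (expR _) dE P2 d12 => d dE P2 d12 bw.
have Q1 : w i * ((1 - d) * phis K tau) <= w i * phiK (width K tau) K 0 by rewrite ler_wpM2l.
have d0 : 0 <= d by lra.
apply: lt_le_trans (_ : _ <
  (w i * (1 - d) - (1 - w i) * (12 / 11 * d) - alpha) * phis K tau) _; last by lra.
rewrite ltr_pM2r //.
have : 0 <= w i * d by rewrite mulr_ge0.
by nra.
Qed.

(** In units of [phis], the wanted atoms leak at most [kap = 7 (beta - omega) / 33], the residual
    ones give at most [omega], and the noise less than [11 (beta - omega) / 33]; the sum stays below
    [omega + 18 (beta - omega) / 33], which is the threshold. *)
Lemma signal_far x : signal_hyp ->
  (forall i (z : int), A i -> tau / K%:R <= `|x - (M * nu i + z%:~R)|) ->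
  cmod (Fsig K tau y x) < thr.
Proof.
move=> H far; have [om0 b1 t0 K0 dE] := signal_params H.
case: H => [[w0 w1 wb wo _] [/andP[a0 a1] ob K24 yy]].
have P0 := phis_gt0 K0 t0.
have [P1 P2] := phis_bounds K0 t0.
have Nz := @Fsig_noise K tau alpha x y _ (ltW t0) yy.
have d12 : expR (- (pi * tau)) <= 1 / 12 by rewrite dE; lra.
pose G := \sum_i w i * phiK (width K tau) K (x - M * nu i).
rewrite (Fsig_exact _ _ _ (ltW t0)) -/G in Nz.
set kap := 28 / 11 * expR (- (pi * tau)).
pose W := \sum_(i | ~~ A i) w i.
have Gn : `|G| <= ((1 - W) * kap + W) * phis K tau.
  apply: le_trans (ler_norm_sum _ _ _) _.
  rewrite (bigID A) /= mulrDl; apply: lerD.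
    have -> : 1 - W = \sum_(i | A i) w i by rewrite -w1 (bigID A) /= addrK.
    rewrite -mulrA mulr_suml; apply: ler_sum => i Ai; rewrite normrM ger0_norm //.
    rewrite ler_wpM2l // phiK_far // => z.
    by rewrite -addrA -opprD far.
  rewrite mulr_suml; apply: ler_sum => i Ai; rewrite normrM ger0_norm // ler_wpM2l //.
  exact: le_trans (phiK_norm _ _ _) P1.
have := cmodD (Fsig K tau y x - creal G) (creal G); rewrite subrK cmod_creal => T.
apply: le_lt_trans T _.
have aP : alpha * phiK (width K tau) K 0 <= alpha * phis K tau by rewrite ler_wpM2l // ltW.
have kapE : kap = 7 / 33 * (beta - omega) by rewrite /kap dE; lra.
apply: le_lt_trans (_ : _ <= (alpha + ((1 - W) * kap + W)) * phis K tau) _.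
  by rewrite mulrDl lerD // (le_trans Nz).
have W0 : 0 <= W by apply: sumr_ge0.
rewrite /thr ltr_pM2r //.
have Wo : W <= omega := wo.
have Wk : 0 <= W * kap by rewrite mulr_ge0 // kapE; lra.
by lra.
Qed.

End Signal.

(** * Arcs and their lifts *)

Section Arcs.
Variable R : realType.
Local Notation comp := (@Defs.comp R).
Local Notation shift := (@Defs.shift R).
Local Notation scale := (@Defs.scale R).
Implicit Types (x y z : R) (A Y : set R).

Lemma comp_self Y x : Y x -> comp Y x x.
Proof.
move=> Yx z zx; have -> // : z = x.
by apply/eqP; rewrite eq_le; case: zx => /andP[-> ->].
Qed.

Lemma comp_sub Y x : comp Y x `<=` Y.
Proof.
by move=> y; apply; have [xy|yx] := lerP x y; [left|right]; rewrite lexx ?xy ?ltW.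
Qed.

Lemma comp_trans Y x y z : comp Y x y -> comp Y y z -> comp Y x z.
Proof.
move=> xy yz v vxz; have [xv|vx] := lerP x v; have [yv|vy] := lerP y v.
- case: vxz => /andP[v1 v2]; first by apply: yz; left; rewrite yv.
  by apply: xy; right; rewrite yv.
- by apply: xy; left; rewrite xv ltW.
- by apply: xy; right; rewrite yv ltW.
- case: vxz => /andP[v1 v2]; first by move: (le_lt_trans v1 vx); rewrite ltxx.
  by apply: yz; right; rewrite v1 ltW.
Qed.

Lemma comp_sym Y x y : comp Y x y -> comp Y y x.
Proof. by move=> xy z [?|?]; apply: xy; [right|left]. Qed.

Lemma comp_eq Y x y : comp Y x y -> comp Y x = comp Y y.
Proof.
move=> xy; apply/seteqP; split=> z; apply: comp_trans => //.
exact: comp_sym.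
Qed.

Lemma comp_shift Y x (q : int) :
  (forall y (k : int), Y y -> Y (y + k%:~R)) ->
  shift (comp Y x) q%:~R = comp Y (x + q%:~R).
Proof.
move=> per; apply/seteqP; split=> [_ [y xy <-] z zxy|y xy].
  rewrite -[z](subrK q%:~R); apply: per; apply: xy.
  by case: zxy => /andP[z1 z2]; [left|right]; apply/andP; split; lra.
exists (y - q%:~R); last by rewrite subrK.
move=> z zxy; rewrite -[z](addrK q%:~R) -mulrNz; apply: per; apply: xy.
by case: zxy => /andP[z1 z2]; [left|right]; apply/andP; split; lra.
Qed.

Lemma closure_realP A x :
  closure A x <-> forall e, 0 < e -> exists2 y, A y & `|x - y| < e.
Proof.
split=> [cA e e0|H B /nbhs_ballP[e e0 eB]].
  have [y [Ay xy]] := cA _ (nbhsx_ballx x e e0).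
  by exists y.
by have [y Ay xy] := H e e0; exists y; split => //; apply: eB.
Qed.

(** Disjoint open sets are separated, so a segment that they cover, being connected, lies in one of
    them. *)
Lemma segment_open_dichotomy (U V : set R) a b : open U -> open V ->
  U `&` V = set0 -> a <= b -> `[a, b]%classic `<=` U `|` V ->
  (U a -> U b) /\ (U b -> U a).
Proof.
move=> oU oV UV0 ab sub.
have sepr (P Q : set R) : open Q -> P `&` Q = set0 -> closure P `&` Q = set0.
  move=> oQ PQ; rewrite -subset0 => x [cPx Qx].
  have [y [Py Qy]] := cPx Q (open_nbhs_nbhs (conj oQ Qx)).
  by have : (P `&` Q) y by []; rewrite PQ.
have sep : separated U V.
  split; first exact: sepr.
  by rewrite setIC sepr // setIC.
have ina : `[a, b]%classic a by rewrite /= in_itv /= lexx.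
have inb : `[a, b]%classic b by rewrite /= in_itv /= lexx ab.
have [sU|sV] := connected_subset sep sub (@segment_connected R a b).
  by split=> _; apply: sU.
split=> [Ua|Ub]; exfalso.
  suff: (U `&` V) a by rewrite UV0.
  by split=> //; apply: sV.
suff: (U `&` V) b by rewrite UV0.
by split=> //; apply: sV.
Qed.

Variables (J : finType) (lam : J -> R) (M r : R) (Y Ep : set R).

(** What the lifting step uses about [Y_l]. The third clause lets every arc be named by a lattice
    point that it contains. *)
Definition lattice_cover : Prop :=
  [/\ forall s (z : int), Y (M * lam s + z%:~R),
      forall y, Y y -> exists s (z : int), `|y - (M * lam s + z%:~R)| < r,
      forall y, Y y -> exists s (z : int), comp Y y (M * lam s + z%:~R) &
      forall y (k : int), Y y -> Y (y + k%:~R)].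

(** What the lifting step uses about [M_l] and [E_{l-1}]: lattice points of different integer shift
    are far apart, and a lift that meets [E_{l-1}] belongs to the shift 0. *)
Definition lattice_separated : Prop :=
  [/\ forall s s' (q : int), q != 0 -> 2 * r <= `|M * lam s - (M * lam s' + q%:~R)|,
      forall z s (q : int), Ep (z / M) -> `|z - (M * lam s + q%:~R)| < r -> q = 0 &
      forall s, Ep (lam s)].

Definition near0 : set R := \bigcup_(s in [set: J]) ball (M * lam s) r.
Definition near1 : set R :=
  \bigcup_(sq in [set sq : J * int | sq.2 != 0]) ball (M * lam sq.1 + sq.2%:~R) r.

Lemma near01_disjoint : lattice_separated -> near0 `&` near1 = set0.
Proof.
move=> [sep _ _]; rewrite -subset0 => z [[s _ zs] [[s' q] /= q0 zs']].
have := sep s s' q q0; rewrite leNgt => /negP; apply.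
rewrite /ball /= in zs zs'.
rewrite -(subrKA z); apply: le_lt_trans (ler_normD _ _) _.
by rewrite (distrC z); lra.
Qed.

(** The segment from [y] to [y'] lies in [Y], hence in the disjoint open sets [near0] and [near1];
    by connectedness it cannot pass from one to the other. *)
Lemma comp_near0 y y' : lattice_cover -> lattice_separated ->
  comp Y y y' -> near0 y -> near0 y'.
Proof.
move=> [_ cov _ _] sep yy' n0.
have op0 : open near0 by apply: bigcup_open => s _; exact: ball_open.
have op1 : open near1 by apply: bigcup_open => s _; exact: ball_open.
have sub a b : comp Y a b -> a <= b -> `[a, b]%classic `<=` near0 `|` near1.
  move=> cab ab z /=; rewrite in_itv /= => zab.
  have /cov[s [q zq]] : Y z by apply: cab; left.
  have [q0|q0] := eqVneq q 0.
    by left; exists s => //; rewrite /ball /= distrC; rewrite q0 mulr0z addr0 in zq.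
  by right; exists (s, q) => //=; rewrite /ball /= distrC.
have d01 := near01_disjoint sep.
have [le|/ltW le] := lerP y y'.
  by have [h _] := segment_open_dichotomy op0 op1 d01 le (sub _ _ yy' le); exact: h.
have [_ h] := segment_open_dichotomy op0 op1 d01 le (sub _ _ (comp_sym yy') le).
exact: h.
Qed.

Lemma near0_lattice s (q : int) : 0 < r -> lattice_separated ->
  near0 (M * lam s + q%:~R) -> q = 0.
Proof.
move=> r0 sep n0; apply/eqP/negPn/negP => q0.
have : (near0 `&` near1) (M * lam s + q%:~R).
  by split=> //; exists (s, q) => //; exact: ballxx.
by rewrite near01_disjoint.
Qed.

Lemma comp_lattice_near0 s : 0 < r -> lattice_cover -> lattice_separated ->
  comp Y (M * lam s) `<=` near0.
Proof.
move=> r0 cov sep y sy; apply: (comp_near0 cov sep sy).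
by exists s => //; exact: ballxx.
Qed.

(* [near1] collects the translates by nonzero integers only, so an arc meeting
   [near0] cannot leave it. *)
Lemma adm_update_exists : 0 < r -> M != 0 -> lattice_cover -> lattice_separated ->
  exists E, adm_update Y M Ep E.
Proof.
move=> r0 M0 cov sep; have [Ylam _ conn per] := cov; have [_ _ Elam] := sep.
have Ylam0 s : Y (M * lam s) by have := Ylam s 0; rewrite addr0.
pose Cs : set (set R) := [set C | exists s, C = comp Y (M * lam s)].
exists (\bigcup_(C in Cs) scale C M), Cs; split; last split=> //.
  move=> _ [s ->]; split; first by exists (M * lam s).
    exists (\sum_s `|M * lam s| + r) => y /(comp_lattice_near0 r0 cov sep)[t _].
    rewrite /ball /= => yt; rewrite -[y](subrK (M * lam t)) addrC.
    apply: le_trans (ler_normD _ _) _; apply: lerD; last by rewrite distrC ltW.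
    by rewrite (bigD1 t) //= lerDl sumr_ge0.
  by exists (M * lam s); split; [exact: comp_self | rewrite mulrAC mulfV // mul1r].
move=> _ [x [Yx ->]]; have [s [z xz]] := conn x Yx.
(* The arc contains [M lam s + z], so the shift [- z] turns it into the arc of [M lam s]. Any other
   shift [q] in [Cs] would put [M lam s + (z + q)] in [near0], which forces [z + q = 0]. *)
exists (- z); split.
  exists s; rewrite comp_shift // (comp_eq (y := M * lam s)) //.
  rewrite -[M * lam s](addrK z%:~R) -mulrNz -comp_shift // mulrNz.
  by exists (M * lam s + z%:~R).
move=> q [s' E]; apply/eqP; rewrite eq_sym -addr_eq0 addrC; apply/eqP.
apply: (@near0_lattice s) => //.
apply: (comp_lattice_near0 (s := s')) => //; rewrite -E.
by exists (M * lam s + z%:~R) => //; rewrite rmorphD /= addrA.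
Qed.

(** A chosen lift meets [Ep] at a point whose nearby lattice point must have shift 0, so the whole
    lift stays in [near0]; this gives the radius. Conversely the arc through [M lam s] has a chosen
    lift, and lying in [near0] forces its shift to be 0. *)
Lemma adm_update_correct E : 0 < r -> 0 < M -> lattice_cover -> lattice_separated ->
  adm_update Y M Ep E ->
  (forall s, E (lam s)) /\ (forall x, E x -> exists s, `|x - lam s| <= r / M).
Proof.
move=> r0 M0 cov sep [Cs [Cs1 [Cs2 ->]]].
have [Ylam cv _ per] := cov; have [_ meet _] := sep.
have Ylam0 s : Y (M * lam s) by have := Ylam s 0; rewrite addr0.
have CsN C : Cs C -> C `<=` near0.
  move=> /Cs1[[x [Yx ->]] _ [z [xz Ez]]] y xy.
  have [s [q zq]] := cv z (comp_sub xz).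
  have q0 := meet z s q Ez zq.
  apply: (comp_near0 (y := z)) => //; first exact: comp_trans (comp_sym xz) xy.
  by exists s => //; rewrite /ball /= distrC; rewrite q0 mulr0z addr0 in zq.
split=> [s|x [C /CsN CN [y Cy <-]]].
  have [|q [Cq _]] := Cs2 (comp Y (M * lam s)); first by exists (M * lam s).
  have q0 : q = 0.
    apply: (@near0_lattice s) => //; apply: (CsN _ Cq).
    by exists (M * lam s) => //; exact: comp_self.
  exists (comp Y (M * lam s)).
    by move: Cq; rewrite q0 comp_shift // addr0.
  exists (M * lam s); first exact: comp_self.
  by rewrite mulrAC mulfV ?mul1r ?gt_eqF.
have [s _] := CN _ Cy; rewrite /ball /= => ys; exists s.
have -> : y / M - lam s = (y - M * lam s) / M.
  by rewrite mulrBl mulrAC mulfV ?mul1r ?gt_eqF.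
by rewrite normrM [`|M^-1|]gtr0_norm ?invr_gt0 // ler_pM2r ?invr_gt0 // distrC ltW.
Qed.

End Arcs.

(** * From the signal bounds to the arcs *)

Section SignalArcs.
Variable R : realType.
Local Notation comp := (@Defs.comp R).

Lemma expiDz2pi (x : R) (z : int) : expi (x + 2 * pi * z%:~R) = expi x.
Proof.
rewrite /expi cosDz2pi; congr Complex.
rewrite -!cosBpihalf -(cosDz2pi (x - pi / 2) z); congr cos; ring.
Qed.

Lemma Fsig_periodic K tau (y : nat -> R[i]) x (z : int) :
  Fsig K tau y (x + z%:~R) = Fsig K tau y x.
Proof.
apply: eq_bigr => i _; congr (_ * _).
rewrite -[RHS](expiDz2pi _ ((i%:Z - K%:Z) * z)); congr expi; rewrite intrM; ring.
Qed.

Variables (I : finType) (w nu : I -> R) (J : finType) (inc : J -> I).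
Variables (beta omega alpha eta : R) (K : nat) (M : R) (y : nat -> R[i]).
Let tau := tau_of beta omega.
Let X := Xset K tau beta omega y.
Let Y := Yset K tau beta omega y.

(** Points of the closure of [X] are within [tau / K] of the lattice, and a point of a filled gap is
    within half of [tau / K] of one of them; [K >= 3 tau / eta] turns [3 / 2] times [tau / K] into
    at most [eta / 2]. *)
Lemma signal_lattice_cover :
  signal_hyp w nu (mem (codom inc)) beta omega alpha K M y ->
  3 * tau / eta <= K%:R -> 0 < eta ->
  lattice_cover (nu \o inc) M (eta / 2) Y.
Proof.
move=> H Keta eta0.
have [_ _ t0 K0 _] := signal_params H.
have KR : 0 < K%:R :> R by rewrite ltr0n.
have tK0 : 0 < tau / K%:R by rewrite divr_gt0.
have tK : 3 / 2 * (tau / K%:R) <= eta / 2.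
  rewrite ler_pdivrMr // in Keta.
  by rewrite mulrA ler_pdivrMr //; lra.
have nearX s (z : int) : X (M * nu (inc s) + z%:~R).
  by apply: (signal_near z H); exact: codom_f.
have clX x : closure X x ->
    exists s (z : int), `|x - (M * nu (inc s) + z%:~R)| < tau / K%:R.
  move=> cx; apply: contrapT => nex.
  have lt : cmod (Fsig K tau y x) < (6 * beta + 5 * omega) / 11 * phis K tau.
    apply: (signal_far H) => i z /codomP[s ->]; rewrite leNgt; apply/negP => lt.
    by apply: nex; exists s, z.
  have cF : continuous (fun x => cmod (Fsig K tau y x)).
    have -> : (fun x => cmod (Fsig K tau y x)) = (fun x => cmod (\sum_(i < (2 * K).+1)
       (yfull y (i%:Z - K%:Z) * creal (phihat K tau (i%:Z - K%:Z))) *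
         expi ((2 * pi * (i%:Z - K%:Z)%:~R) * x))) by [].
    exact: continuous_cmod_trig.
  (* The strict bound at [x] persists nearby by continuity, so [x] cannot be a limit of points above
     the threshold. *)
  have nb : nbhs x [set u | cmod (Fsig K tau y u) < (6 * beta + 5 * omega) / 11 * phis K tau].
    exact: (cvgr_lt _ (cF x) _ lt).
  have [u [Xu /= ult]] := cx _ nb.
  by have := lt_trans ult Xu; rewrite ltxx.
have subX : X `<=` closure X by exact: subset_closure.
have Yseg a b : closure X a -> closure X b -> `|a - b| < tau / K%:R -> comp Y a b.
  move=> ca cb; rewrite ltr_norml => /andP[ab1 ab2] z [zab|zab].
    by exists a, b; split=> //; split=> //; lra.
  by exists b, a; split=> //; split=> //; lra.
have Yper u (k : int) : Y u -> Y (u + k%:~R).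
  have clper a : closure X a -> closure X (a + k%:~R).
    move=> /closure_realP ca; apply/closure_realP => e /ca[v Xv av].
    exists (v + k%:~R); first by rewrite /X /Xset /= Fsig_periodic.
    by rewrite opprD addrACA subrr addr0.
  move=> [a [b [uab [ab [ca cb]]]]]; exists (a + k%:~R), (b + k%:~R).
  split; first by case/andP: uab => *; apply/andP; split; lra.
  by split; [lra | split; apply: clper].
split=> //.
- move=> s z; have nX := subX _ (nearX s z).
  by apply: (comp_sub (Yseg _ _ nX nX _)); rewrite subrr normr0.
- move=> u [a [b [/andP[au ub] [ab [ca cb]]]]].
  have [sa [za ha]] := clX a ca; have [sb [zb hb]] := clX b cb.
  rewrite ltr_norml in ha; rewrite ltr_norml in hb; move: ha hb => /andP[ha1 ha2] /andP[hb1 hb2].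
  rewrite /=; move: tK tK0 ab ha1 ha2 hb1 hb2; move: (tau / K%:R) => t tK tK0 ab ha1 ha2 hb1 hb2.
  have [h|h] := lerP (u - a) (b - u).
    by exists sa, za; rewrite ltr_norml; apply/andP; split; lra.
  by exists sb, zb; rewrite ltr_norml; apply/andP; split; lra.
- move=> u [a [b [/andP[au ub] [ab [ca cb]]]]].
  have [sa [za ha]] := clX a ca; exists sa, za.
  apply: (@comp_trans _ _ _ a); last by apply: Yseg => //; exact/subX/nearX.
  move=> z [] /andP[z1 z2]; exists a, b; split=> //; apply/andP; split; lra.
Qed.

End SignalArcs.

(** * Existence of a good multiplier *)

Section GoodMultiplier.
Variable R : realType.

(** Induction on the number of intervals, removing one that contains the right end [b]; the others
    must cover what lies left of it. *)
Lemma cover_length (s : seq (R * R)) (a b : R) :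
  (forall i, i \in s -> i.1 <= i.2) -> a <= b ->
  (forall x, a <= x <= b -> exists2 i, i \in s & i.1 <= x <= i.2) ->
  b - a <= \sum_(i <- s) (i.2 - i.1).
Proof.
have [n] := ubnP (size s); elim: n s b => // n IH s b sn wf ab cov.
have [|[c d] ins /= /andP[cb bd]] := cov b; first by rewrite ab lexx.
rewrite (perm_big _ (perm_to_rem ins)) big_cons /=.
have wf' i : i \in rem (c, d) s -> i.1 <= i.2 by move=> /mem_rem/wf.
have S0 : 0 <= \sum_(i <- rem (c, d) s) (i.2 - i.1).
  by rewrite big_seq; apply: sumr_ge0 => i /wf'; rewrite subr_ge0.
have [ca|ac] := lerP c a; first lra.
suff : c - a <= \sum_(i <- rem (c, d) s) (i.2 - i.1) by lra.
rewrite leNgt; apply/negP => lt.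
set T := \sum_(i <- _) _ in S0 lt.
(* The point [c] itself may be covered only by the removed interval. If [a + T < c], the midpoint
   [c'] lies strictly between, and the remaining intervals cover [[a, c']] although it is longer
   than [T]. *)
pose c' := (a + T + c) / 2.
have H : c' - a <= T.
  apply: IH => //; last first.
  - move=> x /andP[ax xc].
    have [|i iins ix] := cov x; first by rewrite ax /=; rewrite /c' in xc; lra.
    exists i => //; move: iins; rewrite (perm_mem (perm_to_rem ins)) inE => /predU1P[iE|//].
    by move: ix; rewrite iE /= => /andP[cx _]; rewrite /c' in xc; lra.
  - by rewrite /c'; lra.
  - by rewrite size_rem //; move: sn ins; case: (s).
by rewrite /c' in H; lra.
Qed.

(** A resonance forces [2 (D - 2 eta) <= q <= 4 (D + 2 eta)]. With [q0] the least positive integer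
    above the left side, the right side is at most [2 q0 + 16 eta < 2 q0 + 1]. *)
Lemma resonance_range (D eta : R) : eta <= 1 / 48 -> exists q0 : nat, (0 < q0)%N /\
  forall (q : nat) (v : R), (0 < q)%N -> 1 / 4 <= v <= 1 / 2 ->
    `|D - q%:R * v| <= 2 * eta -> (q0 <= q <= 2 * q0)%N.
Proof.
move=> eta48; pose t := 2 * (D - 2 * eta).
have ex : exists q : nat, (0 < q)%N && (t <= q%:R).
  by exists (Num.trunc t).+1 => /=; rewrite ltW // truncnS_gt.
exists (ex_minn ex); case: ex_minnP => q0 /andP[q00 tq0] qmin; split=> // q v q1.
move=> /andP[v1 v2]; rewrite ler_norml => /andP[h1 h2].
have qR : 1 <= q%:R :> R by rewrite ler1n.
have hv2 : q%:R * v <= q%:R * (1 / 2) by rewrite ler_wpM2l.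
have hv1 : q%:R * (1 / 4) <= q%:R * v by rewrite ler_wpM2l.
apply/andP; split; first by apply: qmin; rewrite q1 /t; lra.
have : q%:R < (2 * q0).+1%:R :> R by rewrite -natr1 natrM; rewrite /t in tq0; lra.
by rewrite ltr_nat ltnS.
Qed.

(** Swapping the entries exchanges pairs with [D > 0] and [D < 0], and the diagonal belongs to
    neither. *)
Lemma count_pos_pairs (J : finType) (D : J * J -> R) :
  (forall s s', D (s', s) = - D (s, s')) ->
  2 * \sum_(p | 0 < D p) 1 <= #|J|%:R * (#|J|%:R - 1) :> R.
Proof.
move=> antisym.
have E : \sum_(p | 0 < D p) 1 = \sum_(p | D p < 0) 1 :> R.
  rewrite (reindex_inj (h := fun p : J * J => (p.2, p.1))) /=; last first.
    by move=> [a b] [c d] [-> ->].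
  by apply: eq_bigl => -[a b] /=; rewrite antisym oppr_gt0.
have card : \sum_(p : J * J) 1 = #|J|%:R ^+ 2 :> R.
  by rewrite sumr_const card_prod natrM expr2.
have diag : #|J|%:R = \sum_(p : J * J | p.1 == p.2) 1 :> R.
  rewrite (reindex_onto (fun s : J => (s, s)) fst) /=; last by move=> [a b] /= /eqP ->.
  by rewrite -[LHS](sumr_const J 1); apply: eq_bigl => s; rewrite !eqxx.
rewrite mulrBr mulr1 -expr2 -card lerBrDr diag mulr_natl mulr2n {2}E.
rewrite !(big_mkcond (fun p => _ < _)) (big_mkcond (fun p : J * J => p.1 == p.2)) -!big_split /=.
apply: ler_sum => -[a b] _ /=.
have [->|ab] := eqVneq a b.
  have -> : D (b, b) = 0 by have := antisym b b; lra.
  by rewrite ltxx !add0r.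
by case: ltgtP => _; rewrite ?add0r ?addr0.
Qed.

(* With v = 1 / m, a bad v satisfies |D p - q v| <= 2 eta for a pair with D p > 0;
   the relevant q lie in [q0, 2 q0] and their intervals have total length at most
   8 eta, while there are at most S (S - 1) / 2 such pairs. *)
Lemma good_m_exists (S : nat) (lam : 'I_S -> R) (eta Mp : R) (Ep : set R) :
  (0 < S)%N -> 0 < eta -> eta <= 1 / (8 * S%:R * (2 * S%:R - 1)) -> 0 < Mp ->
  (forall x, Ep x -> exists s, `|x - lam s| <= eta / 2 / Mp) ->
  exists m, good_m eta Mp Ep m.
Proof.
move=> S0 eta0 etaS M0 EpB.
pose D (p : 'I_S * 'I_S) := Mp * (lam p.2 - lam p.1).
have Danti s s' : D (s', s) = - D (s, s') by rewrite /D /=; ring.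
have SR : 1 <= S%:R :> R by rewrite ler1n.
have main (v : R) : 1 / 4 <= v <= 1 / 2 ->
    (forall p (q : nat), (0 < q)%N -> 2 * eta < `|D p - q%:R * v|) ->
    exists m, good_m eta Mp Ep m.
  move=> /andP[v1 v2] av; have v0 : 0 < v by lra.
  (* A negative [q] is traded for the swapped pair, where [D] changes sign. *)
  have avz p (q : int) : q != 0 -> 2 * eta < `|D p - q%:~R * v|.
    case: p => s s'; case: q => q q0.
      by rewrite -pmulrn; apply: av; rewrite lt0n.
    rewrite NegzE mulrNz -pmulrn -normrN (_ : - _ = D (s', s) - q.+1%:R * v) ?av //.
    by rewrite Danti; ring.
  exists v^-1; split.
    rewrite -[2]invrK -[4]invrK !lef_pV2 ?posrE ?invr_gt0 //.
    by apply/andP; split; lra.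
  (* A point of [G] is within [eta / Mp] of an eigenvalue, half from [Bset] and half from [EpB]; two
     such points differing by [q v / Mp] would give [|D - q v| <= 2 eta]. *)
  move=> /= q q0 x [a [/EpB[s as_] xa]] [b [/EpB[s' bs] xb]].
  have := avz (s, s') q q0; rewrite ltNge => /negP; apply.
  have -> : D (s, s') - q%:~R * v = Mp * ((lam s' - lam s) - q%:~R * v / Mp).
    by rewrite /D /=; field; rewrite gt_eqF.
  rewrite invfM invrK mulrA in xb.
  rewrite invfM mulrA in xa xb as_ bs *.
  rewrite normrM gtr0_norm // mulrC -ler_pdivlMr //.
  have -> : 2 * eta / Mp = 4 * (eta / 2 / Mp) by field; rewrite gt_eqF.
  move: (eta / 2 / Mp) xa xb as_ bs => h.
  have -> : q%:~R / Mp * v = q%:~R * v / Mp by rewrite mulrAC.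
  by move: (q%:~R * v / Mp) => e; rewrite !ler_norml; lra.
(* For [S = 1] only [eta <= 1 / 8] is available, but then [D] vanishes and [v = 1 / 2] works;
   [S >= 2] gives [eta <= 1 / 48]. *)
have [S1|S1] := leqP S 1.
  have SE : S%:R = 1 :> R by rewrite (_ : S = 1%N) //; lia.
  have eta8 : eta <= 1 / 8 by move: etaS; rewrite SE (_ : 8 * 1 * (2 * 1 - 1) = 8 :> R) //; ring.
  apply: (main (1 / 2)); first lra.
  move=> [s s'] q q0.
  have -> : D (s, s') = 0.
    rewrite /D /= (_ : s = s') ?subrr ?mulr0 //.
    by apply: ord_inj; have := ltn_ord s; have := ltn_ord s'; lia.
  have qR : 1 <= q%:R :> R by rewrite ler1n.
  by rewrite sub0r normrN ger0_norm; lra.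
have S2 : 2 <= S%:R :> R by rewrite ler_nat.
have eta48 : eta <= 1 / 48.
  apply: le_trans etaS _; rewrite !div1r lef_pV2 ?posrE ?mulr_gt0 //; try lra.
  by nra.
have [q0 q0P] := choice (fun p => resonance_range (D p) eta48).
pose s := [seq ((D pq.1 - 2 * eta) / pq.2%:R, (D pq.1 + 2 * eta) / pq.2%:R) |
  pq <- [seq (p, q) | p <- [seq p <- index_enum _ | 0 < D p],
    q <- index_iota (q0 p) (2 * q0 p).+1]].
have [v vitv av] : exists2 v, 1 / 4 <= v <= 1 / 2 &
    forall i, i \in s -> ~~ (i.1 <= v <= i.2).
  apply: contrapT => nex.
  have wf i : i \in s -> i.1 <= i.2.
    move=> /mapP[[p q] _ -> /=]; rewrite ler_wpM2r ?invr_ge0 //; lra.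
  have cov x : 1 / 4 <= x <= 1 / 2 -> exists2 i, i \in s & i.1 <= x <= i.2.
    move=> xitv; apply: contrapT => nx; apply: nex; exists x => // i si.
    by apply/negP => ix; apply: nx; exists i.
  have ab : 1 / 4 <= 1 / 2 :> R by lra.
  have := cover_length wf ab cov; apply/negP; rewrite -ltNge.
  rewrite big_map big_allpairs_dep /= big_filter.
  apply: (@le_lt_trans _ _ (\sum_(p | 0 < D p) 8 * eta)).
    apply: ler_sum => p _; have [q00 _] := q0P p.
    have q0R : 1 <= (q0 p)%:R :> R by rewrite ler1n.
    (* The interval of [q] has length [4 eta / q <= 4 eta / q0], and there are [q0 + 1 <= 2 q0] of
       them. *)
    apply: (@le_trans _ _ (\sum_(q0 p <= q < (2 * q0 p).+1) 4 * eta / (q0 p)%:R)).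
      rewrite big_nat [leRHS]big_nat; apply: ler_sum => q /andP[qq _].
      rewrite -mulrBl (_ : _ - _ = 4 * eta); last by ring.
      rewrite ler_wpM2l ?lef_pV2 ?posrE ?ler_nat ?ltr0n //; last by apply: leq_trans qq.
      by lra.
    rewrite sumr_const_nat (_ : (2 * q0 p).+1 - q0 p = (q0 p).+1)%N; last lia.
    rewrite -[leLHS]mulr_natr mulrAC ler_pdivrMr -?natr1; last lra.
    by nra.
  have := count_pos_pairs Danti; rewrite card_ord.
  rewrite (_ : \sum_(p | 0 < D p) 8 * eta = 8 * eta * \sum_(p | 0 < D p) 1); last first.
    by rewrite mulr_sumr; apply: eq_bigr => p _; rewrite mulr1.
  move: (\sum_(p | 0 < D p) 1) => N NS.
  have etaS' : eta * (8 * S%:R * (2 * S%:R - 1)) <= 1.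
    by rewrite -ler_pdivlMr //; nra.
  have h1 : eta * (2 * N) <= eta * (S%:R * (S%:R - 1)) by rewrite ler_wpM2l // ltW.
  (* Since [S - 1 < (2 S - 1) / 2], the left side is below [2 eta S (2 S - 1) <= 1 / 4], by the
     bound on [eta]. *)
  have h2 : eta * (S%:R * (S%:R - 1)) * 4 < 1 / 4.
    have : 0 < eta * S%:R by rewrite mulr_gt0 //; lra.
    by lra.
  by lra.
apply: (main v vitv) => p q q1; rewrite ltNge; apply/negP => le.
have /andP[v1 v2] := vitv.
have qR : 1 <= q%:R :> R by rewrite ler1n.
have [Dp|Dp] := lerP (D p) 0.
  move: le; rewrite ler_norml; nra.
have qr := (q0P p).2 q v q1 vitv le.
have /av : ((D p - 2 * eta) / q%:R, (D p + 2 * eta) / q%:R) \in s.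
  apply/mapP; exists (p, q) => //; apply/allpairsPdep; exists p, q; split=> //.
    by rewrite mem_filter Dp mem_index_enum.
  by rewrite mem_index_iota ltnS.
move: le; rewrite ler_norml => /andP[h1 h2]; move=> /negP; apply => /=.
by rewrite ler_pdivrMr ?ler_pdivlMr; lra.
Qed.

End GoodMultiplier.

(** * Concentration of the Hadamard-test averages *)

Section Hoeffding.
Variable R : realType.

(* With N h = E e^(h X), the function N' / N - mu - h has derivative
   - (N' / N)^2 <= 0, so N h e^(- mu h - h^2 / 2) decreases on h >= 0. *)
Lemma hoeffding_sign (mu h : R) : `|mu| <= 1 -> 0 <= h ->
  (1 + mu) / 2 * expR (h * (1 - mu)) + (1 - mu) / 2 * expR (h * (-1 - mu)) <= expR (h ^+ 2 / 2).
Proof.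
rewrite ler_norml => /andP[mu1 mu2] h0.
pose N (x : R) := (1 + mu) / 2 * expR x + (1 - mu) / 2 * expR (- x).
pose N' (x : R) := (1 + mu) / 2 * expR x - (1 - mu) / 2 * expR (- x).
have dexpN (x : R) : is_derive x 1 (fun y : R => expR (- y)) (- expR (- x)).
  have H := @is_derive1_comp R expR (fun y => - y) x (expR (- x)) (-1).
  by rewrite -mulrN1; apply: H.
have dN (x : R) : is_derive x 1 N (N' x).
  have ? := dexpN x; rewrite /N /N'; apply: is_derive_eq; rewrite /GRing.scale /=; ring.
have dN' (x : R) : is_derive x 1 N' (N x).
  have ? := dexpN x; rewrite /N /N'; apply: is_derive_eq; rewrite /GRing.scale /=; ring.
have N0 x : 0 < N x.
  have e1 := expR_gt0 x; have e2 := expR_gt0 (- x).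
  have [m0|m0] := lerP 0 mu.
    by rewrite /N ltr_pwDl ?mulr_gt0 ?mulr_ge0 ?(ltW e2) //; lra.
  by rewrite /N ltr_wpDl ?mulr_gt0 ?mulr_ge0 ?(ltW e1) //; lra.
have N00 : N 0 = 1 by rewrite /N oppr0 expR0; lra.
have N'00 : N' 0 = mu by rewrite /N' oppr0 expR0; lra.
have NhE : N h = (1 + mu) / 2 * expR h + (1 - mu) / 2 * expR (- h) by [].
clearbody N N'.
have T0 (x : R) : 0 <= x -> N' x <= (mu + x) * N x.
  move=> x0; rewrite -ler_pdivrMr // -subr_le0.
  rewrite -[X in _ <= X](_ : N' 0 / N 0 - (mu + 0) = 0); last first.
    by rewrite N00 N'00 addr0 divr1 subrr.
  apply: (@ger_of_derive_le0 R (fun y => N' y / N y - (mu + y))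
    (fun y => - (N' y / N y) ^+ 2) _ _ x0).
    move=> y; have ? := dN y; have ? := dN' y.
    have NN : N y != 0 by rewrite gt_eqF.
    have ? := is_deriveV NN (dN y).
    apply: is_derive_eq; rewrite /GRing.scale /=.
    by move: (N y) (N' y) NN => a b aN; field.
  by move=> y _; rewrite oppr_le0 sqr_ge0.
have Q : N h * expR (- (mu * h + h ^+ 2 / 2)) <= 1.
  rewrite -[X in _ <= X](_ : N 0 * expR (- (mu * 0 + 0 ^+ 2 / 2)) = 1); last first.
    by rewrite N00 expr0n mulr0 mul0r addr0 oppr0 expR0 mulr1.
  apply: (@ger_of_derive_le0 R (fun y => N y * expR (- (mu * y + y ^+ 2 / 2)))
    (fun y => (N' y - (mu + y) * N y) * expR (- (mu * y + y ^+ 2 / 2))) _ _ h0).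
    move=> y; have ? := dN y.
    have d1 : is_derive y 1 (fun z : R => - (mu * z + z ^+ 2 / 2)) (- (mu + y)).
      by apply: is_derive_eq; rewrite /GRing.scale /=; field.
    have ? : is_derive y 1 (fun z : R => expR (- (mu * z + z ^+ 2 / 2)))
       (expR (- (mu * y + y ^+ 2 / 2)) * - (mu + y)).
      exact: (@is_derive1_comp R expR (fun z : R => - (mu * z + z ^+ 2 / 2))).
    by apply: is_derive_eq; rewrite /GRing.scale /=; ring.
  by move=> y /andP[y0 _]; rewrite mulr_le0_ge0 ?expR_ge0 // subr_le0 T0.
rewrite expRN ler_pdivrMr ?expR_gt0 // mul1r addrC expRD in Q.
have -> : h * (1 - mu) = h + - (mu * h) by ring.
have -> : h * (-1 - mu) = - h + - (mu * h) by ring.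
rewrite !expRD !mulrA -mulrDl -NhE expRN ler_pdivrMr ?expR_gt0 //.
Qed.

Variables (T : finType) (mn : T -> R).
Hypothesis mn1 : forall i, `|mn i| <= 1.

Definition coin (i : T) (b : bool) : R := if b then (1 + mn i) / 2 else (1 - mn i) / 2.

Lemma coin_ge0 i b : 0 <= coin i b.
Proof. by have := mn1 i; rewrite ler_norml /coin => /andP[? ?]; case: b; lra. Qed.

Lemma coins_sum1 : \sum_(o : {ffun T -> bool}) \prod_i coin i (o i) = 1.
Proof.
rewrite -(bigA_distr_bigA coin) big1 // => i _; rewrite big_bool /coin /=; lra.
Qed.

Lemma coin_mgf i (sg : bool) (c : R) : 0 <= c ->
  coin i true * expR (c * (sgnb R sg * (sgnb R true - mn i))) +
  coin i false * expR (c * (sgnb R sg * (sgnb R false - mn i))) <= expR (c ^+ 2 / 2).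
Proof.
move=> c0; rewrite /coin /sgnb; case: sg; first by rewrite !mul1r; exact: hoeffding_sign.
have := @hoeffding_sign (- mn i) c; rewrite normrN => /(_ (mn1 i) c0).
rewrite opprK addrC.
have -> : -1 * (1 - mn i) = -1 + mn i by ring.
by have -> : -1 * (-1 - mn i) = 1 + mn i by ring.
Qed.

(** Chernoff bound with exponent [c], the optimal one for a deviation of [c] per coin: the moment
    bound [e^(c^2 / 2)] per coin meets the factor [e^(- c^2)]. *)
Lemma hoeffding_tail (B : pred T) (sg : bool) (c : R) : 0 <= c ->
  \sum_(o : {ffun T -> bool} | #|B|%:R * c < \sum_(i | B i) sgnb R sg * (sgnb R (o i) - mn i))
     \prod_i coin i (o i) <= expR (- (#|B|%:R * (c ^+ 2 / 2))).
Proof.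
move=> c0; pose Z (o : {ffun T -> bool}) := \sum_(i | B i) sgnb R sg * (sgnb R (o i) - mn i).
apply: (@le_trans _ _ (\sum_(o : {ffun T -> bool})
   (\prod_i coin i (o i)) * expR (c * Z o - c * (#|B|%:R * c)))).
  rewrite big_mkcond; apply: ler_sum => o _.
  have w0 : 0 <= \prod_i coin i (o i) by apply: prodr_ge0 => i _; exact: coin_ge0.
  case: ifP => [lt|_]; last by rewrite mulr_ge0 ?expR_ge0.
  rewrite ler_peMr //; apply: le_trans (expR_ge1Dx _); rewrite lerDl subr_ge0.
  by rewrite ler_wpM2l // ltW.
under eq_bigr do rewrite expRD mulrA.
rewrite -mulr_suml.
(* Coins outside [B] get the factor 1, so the sum over all tables still factors over the coins. *)
pose e (i : T) (b : bool) := coin i b *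
  (if B i then expR (c * (sgnb R sg * (sgnb R b - mn i))) else 1).
rewrite (eq_bigr (fun o : {ffun T -> bool} => \prod_i e i (o i))); last first.
  move=> o _; rewrite /e big_split /=; congr (_ * _).
  by rewrite -big_mkcond /= -expR_sum mulr_sumr.
rewrite -(bigA_distr_bigA e).
have le : \prod_i \sum_b e i b <= \prod_(i | B i) expR (c ^+ 2 / 2).
  rewrite [leRHS]big_mkcond; apply: ler_prod => i _; rewrite big_bool /=.
  apply/andP; split.
    by rewrite addr_ge0 // mulr_ge0 ?coin_ge0 //; case: ifP; rewrite ?expR_ge0.
  rewrite /e; case: ifP => Bi; last by rewrite /coin; lra.
  exact: coin_mgf.
apply: le_trans (_ : (\prod_(i | B i) expR (c ^+ 2 / 2)) * expR (- (c * (#|B|%:R * c))) <= _).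
  by rewrite ler_wpM2r ?expR_ge0.
rewrite prodr_const -expRM_natr -expRD ler_expR.
by rewrite le_eqVlt; apply/orP; left; apply/eqP; field.
Qed.

End Hoeffding.

(** * Accuracy of one round of Hadamard tests *)

Section Sampling.
Variable R : realType.

Lemma sum_fst_eq (V : nmodType) (A B : finType) (a : A) (F : A * B -> V) :
  \sum_(i | i.1 == a) F i = \sum_b F (a, b).
Proof.
rewrite (reindex_onto (fun b => (a, b)) snd) /=; last by move=> [a' b] /= /eqP ->.
by apply: eq_bigl => b; rewrite !eqxx.
Qed.

Lemma card_fst_eq (A B : finType) (a : A) :
  #|[pred i : A * B | i.1 == a]| = #|B|.
Proof. by rewrite -sum1_card (sum_fst_eq a (fun=> 1%N)) sum1_card. Qed.

Variables (g : R -> R[i]) (M : R) (K Nh : nat).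

Definition table_mean (i : 'I_K.+1 * bool * 'I_Nh) : R :=
  if i.1.2 then complex.Im (g (M * (nat_of_ord i.1.1)%:R))
  else complex.Re (g (M * (nat_of_ord i.1.1)%:R)).

Lemma table_weightE (o : table K Nh) :
  table_weight g M o = \prod_i coin table_mean i (o i).
Proof. by []. Qed.

Definition table_good (alpha : R) (o : table K Nh) : bool :=
  [forall k : 'I_K.+1, cmod (yest R o k - g (M * k%:R)) <= alpha].

(** [x.1] is the pair of [k] and variant, [x.2] the direction of a one-sided deviation: the
    [4 (K + 1)] events of the union bound. *)
Definition deviates (c : R) (x : 'I_K.+1 * bool * bool) (o : table K Nh) : bool :=
  #|[pred i : 'I_K.+1 * bool * 'I_Nh | i.1 == x.1]|%:R * c <
  \sum_(i | [pred i : 'I_K.+1 * bool * 'I_Nh | i.1 == x.1] i)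
     sgnb R x.2 * (sgnb R (o i) - table_mean i).

(** Errors of at most [alpha / sqrt 2] in the real and in the imaginary part give a modulus of at
    most [alpha]. *)
Lemma table_good_deviates (alpha : R) o : (0 < Nh)%N -> 0 < alpha ->
  ~~ table_good alpha o -> exists x, deviates (alpha / Num.sqrt 2) x o.
Proof.
move=> N0 a0 /forallPn[k]; apply: contraPP => nex; apply/negP/negPn.
set c := alpha / Num.sqrt 2 in nex.
have NR : 0 < Nh%:R :> R by rewrite ltr0n.
have s2 : 0 < Num.sqrt 2 :> R by rewrite sqrtr_gt0.
have c2 : c ^+ 2 + c ^+ 2 = alpha ^+ 2.
  by rewrite /c exprMn exprVn sqr_sqrtr //; lra.
have dev v : `|(\sum_(j < Nh) sgnb R (o (k, v, j))) / Nh%:R -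
    (if v then complex.Im (g (M * k%:R)) else complex.Re (g (M * k%:R)))| <= c.
  set mn := (if v then _ else _).
  have D sg : sgnb R sg * (\sum_(j < Nh) sgnb R (o (k, v, j)) - Nh%:R * mn) <= Nh%:R * c.
    rewrite leNgt; apply/negP => lt; apply: nex; exists (k, v, sg).
    rewrite /deviates card_fst_eq card_ord /= (sum_fst_eq (k, v)) /table_mean /= -/mn.
    by rewrite -mulr_sumr sumrB sumr_const card_ord -[X in _ - X]mulr_natl.
  move: D; set A := \sum_j _ => D.
  have d1 : A - Nh%:R * mn <= Nh%:R * c by have := D true; rewrite [sgnb _ _]/= mul1r.
  have d2 : - (A - Nh%:R * mn) <= Nh%:R * c by have := D false; rewrite [sgnb _ _]/= mulN1r.
  have -> : A / Nh%:R - mn = (A - Nh%:R * mn) / Nh%:R.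
    by rewrite mulrBl [_ * mn]mulrC mulfK ?gt_eqF.
  rewrite normrM [`|_^-1|]gtr0_norm ?invr_gt0 // ler_pdivrMr // [c * _]mulrC.
  by rewrite ler_norml d1 andbT lerNl.
have sq x : `|x| <= c -> x ^+ 2 <= c ^+ 2.
  move=> xc; rewrite -[x ^+ 2]real_normK ?num_real // lerXn2r ?nnegrE //.
  exact: le_trans xc.
have := dev false; have := dev true => /sq h1 /sq h2.
rewrite /yest valK /=; case: (g (M * k%:R)) h1 h2 => a b /= h1 h2.
rewrite /cmod /= -[leRHS](ger0_norm (ltW a0)) -sqrtr_sqr ler_wsqrtr // -c2.
exact: lerD.
Qed.

Lemma table_concentration (alpha : R) : (0 < Nh)%N -> 0 < alpha ->
  (forall t, `|complex.Re (g t)| <= 1 /\ `|complex.Im (g t)| <= 1) ->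
  1 - 4 * (K%:R + 1) * expR (- (Nh%:R * alpha ^+ 2 / 4)) <=
  \sum_(o : table K Nh | table_good alpha o) table_weight g M o.
Proof.
move=> N0 a0 g1.
have m1 i : `|table_mean i| <= 1.
  by rewrite /table_mean; case: ifP => _; have [] := g1 (M * (nat_of_ord i.1.1)%:R).
have W0 o : 0 <= \prod_i coin table_mean i (o i).
  by apply: prodr_ge0 => i _; exact: coin_ge0.
have tot := coins_sum1 table_mean.
rewrite (bigID (table_good alpha)) /= in tot.
rewrite lerBlDr -[X in X <= _]tot lerD2l.
set c := alpha / Num.sqrt 2.
have c0 : 0 <= c by rewrite divr_ge0 ?sqrtr_ge0 ?ltW.
apply: (@le_trans _ _ (\sum_x \sum_(o | deviates c x o) \prod_i coin table_mean i (o i))).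
  under [leRHS]eq_bigr do rewrite big_mkcond.
  rewrite exchange_big /= big_mkcond; apply: ler_sum => o _.
  case: ifPn => [/(table_good_deviates N0 a0)[x dx]|_].
    rewrite (bigD1 x) //= dx lerDl sumr_ge0 // => x' _; by case: ifP.
  by apply: sumr_ge0 => x' _; case: ifP.
apply: (@le_trans _ _ (\sum_(x : 'I_K.+1 * bool * bool) expR (- (Nh%:R * alpha ^+ 2 / 4)))).
  apply: ler_sum => x _.
  apply: le_trans (hoeffding_tail m1 [pred i | i.1 == x.1] x.2 c0) _.
  rewrite card_fst_eq card_ord ler_expR lerN2.
  by rewrite /c exprMn exprVn sqr_sqrtr // le_eqVlt; apply/orP; left; apply/eqP; field.
rewrite sumr_const !card_prod card_ord card_bool -[leLHS]mulr_natl.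
by rewrite !natrM -natr1 ler_wpM2r ?expR_ge0 //; lra.
Qed.

(** The sample size is at least [4 l / alpha^2], where [e^(- l) = rho / (4 (L + 1) (K + 1))]: the
    share of one round among [L + 1], divided by its [4 (K + 1)] events. *)
Lemma Nhalf_failure (alpha rho eta eps : R) (L : nat) : 0 < alpha -> 0 < rho < 1 ->
  Num.ceil (ln (eta / eps) / ln 2) = L%:Z ->
  (0 < Nhalf alpha rho eta eps K)%N /\
  4 * (K%:R + 1) * expR (- ((Nhalf alpha rho eta eps K)%:R * alpha ^+ 2 / 4)) <= rho / (L%:R + 1).
Proof.
move=> a0 /andP[r0 r1] LE; rewrite /Nhalf LE -pmulrn.
have K0 : 1 <= K%:R + 1 :> R by rewrite lerDr.
have L0 : 1 <= L%:R + 1 :> R by rewrite lerDr.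
have r4 : 1 < 4 / rho by rewrite ltr_pdivlMr //; lra.
set l := ln (4 / rho) + _ + _.
have l0 : 0 < l by rewrite /l !ltr_wpDr ?ln_ge0 ?ln_gt0.
have a2 : 0 < alpha ^+ 2 by rewrite exprn_gt0.
set Q := 4 / alpha ^+ 2 * l.
have Q0 : 0 < Q by rewrite mulr_gt0 ?divr_gt0.
have cQ : Q <= (`|Num.ceil Q|%N)%:R.
  by rewrite pmulrn gez0_abs ?ceil_ge0 ?ceil_ge //; lra.
split; first by rewrite -(ltr_nat R); apply: lt_le_trans cQ.
have : expR (- (`|Num.ceil Q|%N%:R * alpha ^+ 2 / 4)) <= expR (- l).
  rewrite ler_expR lerN2 ler_pdivlMr // -ler_pdivrMr //.
  by apply: le_trans cQ; rewrite /Q; lra.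
rewrite [expR (- l)]expRN /l !expRD !lnK ?posrE ?divr_gt0 //; try lra.
move=> H; apply: le_trans (ler_wpM2l _ H) _; first by lra.
rewrite le_eqVlt; apply/orP; left; apply/eqP; field.
by apply/and3P; split; rewrite gt_eqF //; lra.
Qed.

End Sampling.

(** * Spectral form of the Hadamard-test mean *)

Section Spectral.
Variable R : realType.
Local Notation C := (R[i]).

Lemma cconjE : @cconj R = @conjc R.
Proof. by apply/funext => -[a b]. Qed.

Lemma adjE m p (A : 'M[C]_(m, p)) : adj A = map_mx (@conjc R) A^T.
Proof. by rewrite /adj cconjE. Qed.

Lemma adjM m n p (A : 'M[C]_(m, n)) (B : 'M[C]_(n, p)) : adj (A *m B) = adj B *m adj A.
Proof. by rewrite !adjE trmx_mul map_mxM. Qed.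

Lemma adjK m p (A : 'M[C]_(m, p)) : adj (adj A) = A.
Proof. by rewrite !adjE; apply/matrixP => i j; rewrite !mxE conjcK. Qed.

Lemma cinnerDl n (u v x : 'cV[C]_n) : cinner (u + v) x = cinner u x + cinner v x.
Proof. by rewrite /cinner !adjE linearD /= map_mxD mulmxDl mxE. Qed.

Lemma cinnerDr n (u v x : 'cV[C]_n) : cinner x (u + v) = cinner x u + cinner x v.
Proof. by rewrite /cinner mulmxDr mxE. Qed.

Lemma cinnerZl n a (u x : 'cV[C]_n) : cinner (a *: u) x = conjc a * cinner u x.
Proof. by rewrite /cinner !adjE linearZ /= map_mxZ -scalemxAl mxE. Qed.

Lemma cinnerZr n a (u x : 'cV[C]_n) : cinner x (a *: u) = a * cinner x u.
Proof. by rewrite /cinner -scalemxAr mxE. Qed.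

Lemma cinner0l n (x : 'cV[C]_n) : cinner 0 x = 0.
Proof. by rewrite -(scale0r x) cinnerZl conjc0 mul0r. Qed.

Lemma cinner0r n (x : 'cV[C]_n) : cinner x 0 = 0.
Proof. by rewrite -(scale0r x) cinnerZr mul0r. Qed.

Lemma cinner_suml n (I : finType) (F : I -> 'cV[C]_n) x :
  cinner (\sum_i F i) x = \sum_i cinner (F i) x.
Proof.
apply: (big_morph (fun u => cinner u x)); last exact: cinner0l.
by move=> u v; rewrite cinnerDl.
Qed.

Lemma cinner_sumr n (I : finType) (F : I -> 'cV[C]_n) x :
  cinner x (\sum_i F i) = \sum_i cinner x (F i).
Proof.
apply: (big_morph (cinner x)); last exact: cinner0r.
by move=> u v; rewrite cinnerDr.
Qed.

Lemma cinner_conj n (u v : 'cV[C]_n) : cinner u v = conjc (cinner v u).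
Proof.
have E : adj u *m v = adj (adj v *m u) by rewrite adjM adjK.
by rewrite /cinner E adjE !mxE.
Qed.

Lemma cinner_adj n (A : 'M[C]_n) (u v : 'cV[C]_n) : cinner u (A *m v) = cinner (adj A *m u) v.
Proof. by rewrite /cinner adjM adjK mulmxA. Qed.

Lemma conjcM_cmod (z : C) : conjc z * z = creal (cmod z ^+ 2).
Proof. by case: z => a b; rewrite sqr_cmod /creal /=; simpc; congr Complex; ring. Qed.

Variables (n : nat) (V : 'M[C]_n) (mu : 'I_n -> R).
Hypothesis Vunit : adj V *m V = 1%:M.

Lemma unitary_mulmx_adj : V *m adj V = 1%:M.
Proof. exact: mulmx1C. Qed.

Lemma adj_Upow t : adj (Upow V mu t) = Upow V mu (- t).
Proof.
rewrite /Upow !adjM adjK mulmxA; congr (_ *m _ *m _).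
apply/matrixP => i j; rewrite adjE !mxE eq_sym.
case: eqP => [->|_]; last by rewrite !mulr0n conjc0.
by rewrite !mulr1n -cconjE cconj_expi mulrN.
Qed.

Lemma Upow0 : Upow V mu 0 = 1%:M.
Proof.
rewrite /Upow (_ : \row_j _ = const_mx 1).
  by rewrite diag_const_mx mulmx1 unitary_mulmx_adj.
by apply/matrixP => i j; rewrite !mxE mulr0 oppr0 expi0.
Qed.

(** In the basis [V] the coordinate [j] of an eigenvector is zero unless [mu j = l], so both
    diagonal matrices act on it by a scalar. *)
Lemma Upow_eigen (v : 'cV[C]_n) (l t : R) : Hmat V mu *m v = creal l *: v ->
  Upow V mu t *m v = expi (- (2 * pi * l * t)) *: v.
Proof.
move=> Hv.
have {}Hv : diag_mx (\row_j creal (mu j)) *m (adj V *m v) = creal l *: (adj V *m v).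
  by rewrite scalemxAr -Hv /Hmat !mulmxA Vunit mul1mx.
rewrite /Upow -!mulmxA.
have -> : diag_mx (\row_j expi (- (2 * pi * mu j * t))) *m (adj V *m v) =
   expi (- (2 * pi * l * t)) *: (adj V *m v).
  move: Hv; move: (adj V *m v) => a Ha; apply/matrixP => i j.
  have := congr1 (fun A : 'cV[C]_n => A i j) Ha.
  rewrite /= !mul_diag_mx !mxE => E.
  have [a0|a0] := eqVneq (a i j) 0; first by rewrite a0 !mulr0.
  by have [->] := mulIf a0 E.
by rewrite -scalemxAr mulmxA unitary_mulmx_adj mul1mx.
Qed.

Variables (S : nat) (psis : 'I_S -> 'cV[C]_n) (lam : 'I_S -> R) (c : 'I_S -> C).
Variables (psires : 'cV[C]_n) (cres : C) (psi : 'cV[C]_n).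

(** The left summand indexes the vectors [psi_s], the right one the components of the residual
    vector along the columns of [V]. Frequencies may repeat across the two. *)
Definition spec_weight (i : 'I_S + 'I_n) : R :=
  match i with
  | inl s => cmod (c s) ^+ 2
  | inr j => cmod cres ^+ 2 * cmod ((adj V *m psires) j 0) ^+ 2
  end.

Definition spec_freq (i : 'I_S + 'I_n) : R :=
  match i with inl s => lam s | inr j => mu j end.

Hypothesis ortho : forall s s', cinner (psis s) (psis s') = (s == s')%:R.
Hypothesis eigen : forall s, Hmat V mu *m psis s = creal (lam s) *: psis s.
Hypothesis res1 : cinner psires psires = 1.
Hypothesis res0 : forall s, cinner (psis s) psires = 0.
Hypothesis psiE : psi = \sum_(s < S) c s *: psis s + cres *: psires.

Lemma cinner_psires t : cinner psires (Upow V mu t *m psires) =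
  \sum_j creal (cmod ((adj V *m psires) j 0) ^+ 2) * expi (- (2 * pi * mu j * t)).
Proof.
rewrite /Upow -!mulmxA cinner_adj; set b := adj V *m psires.
rewrite /cinner mxE; apply: eq_bigr => j _.
rewrite mul_diag_mx adjE !mxE mulrCA mulrC; congr (_ * _).
exact: conjcM_cmod.
Qed.

(** The cross terms vanish because [U^t] and its adjoint both map [psi_s] to a multiple of itself,
    orthogonal to the residual vector. *)
Lemma hmean_spectral t : hmean V mu psi t = spectral_mean spec_weight spec_freq t.
Proof.
have Ueig s : Upow V mu t *m psis s = expi (- (2 * pi * lam s * t)) *: psis s.
  exact: Upow_eigen.
have cross1 s : cinner psires (psis s) = 0 by rewrite cinner_conj res0 conjc0.
have cross2 s : cinner (psis s) (Upow V mu t *m psires) = 0.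
  by rewrite cinner_adj adj_Upow (Upow_eigen _ (eigen s)) cinnerZl res0 mulr0.
rewrite /spectral_mean big_sumType /= /hmean psiE mulmxDr mulmx_sumr -scalemxAr.
have Z : cinner (\sum_(s < S) c s *: psis s) (Upow V mu t *m psires) = 0.
  by rewrite cinner_suml big1 // => s _; rewrite cinnerZl cross2 mulr0.
rewrite cinnerDl !cinnerDr !cinnerZl !cinnerZr Z mulr0 addr0 cinner_suml.
congr (_ + _).
  apply: eq_bigr => s _; rewrite cinner_sumr (bigD1 s) //= big1 ?addr0.
    rewrite -scalemxAr Ueig cinnerZl !cinnerZr ortho eqxx mulr1.
    by rewrite mulrA conjcM_cmod.
  move=> s' s's; rewrite -scalemxAr Ueig cinnerZl !cinnerZr ortho.
  by rewrite eq_sym (negbTE s's) !mulr0.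
rewrite cinner_sumr big1 ?mulr0 ?add0r; last first.
  by move=> s _; rewrite -scalemxAr Ueig !cinnerZr cross1 !mulr0.
rewrite cinner_psires mulrA conjcM_cmod mulr_sumr; apply: eq_bigr => j _.
by rewrite mulrA; congr (_ * _); rewrite /creal; simpc.
Qed.

Lemma spec_weight_ge0 i : 0 <= spec_weight i.
Proof. by case: i => s; [exact: sqr_ge0 | exact: mulr_ge0 (sqr_ge0 _) (sqr_ge0 _)]. Qed.

Lemma sum_spec_weight : cinner psi psi = 1 -> \sum_i spec_weight i = 1.
Proof.
move=> psi1.
have : hmean V mu psi 0 = 1 by rewrite /hmean Upow0 mul1mx.
rewrite hmean_spectral /spectral_mean => /(congr1 (@complex.Re R)).
rewrite Re_sum /= => <-; apply: eq_bigr => i _.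
by rewrite mulr0 oppr0 cos0 sin0 mul0r subr0 mulr1.
Qed.

Lemma sum_spec_weight_res :
  \sum_(i | i \notin codom (@inl 'I_S 'I_n)) spec_weight i = cmod cres ^+ 2.
Proof.
rewrite big_sumType /= big_pred0 ?add0r; last by move=> s; rewrite codom_f.
rewrite (eq_bigl xpredT); last by move=> j; apply/negP => /codomP[].
rewrite -mulr_sumr -[RHS]mulr1; congr (_ * _).
have := cinner_psires 0; rewrite Upow0 mul1mx res1 => /(congr1 (@complex.Re R)).
rewrite Re_sum /= => ->; apply: eq_bigr => j _.
by rewrite mulr0 oppr0 cos0 sin0 mul0r subr0 mulr1.
Qed.

Lemma spectral_mean_le1 (I : finType) (w nu : I -> R) t :
  (forall i, 0 <= w i) -> \sum_i w i = 1 ->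
  `|complex.Re (spectral_mean w nu t)| <= 1 /\ `|complex.Im (spectral_mean w nu t)| <= 1.
Proof.
move=> w0 w1; rewrite /spectral_mean Re_sum Im_sum.
split; apply: le_trans (ler_norm_sum _ _ _) _; rewrite -[leRHS]w1; apply: ler_sum => i _ /=.
  by rewrite mul0r subr0 normrM ger0_norm // ler_piMr ?cos_max.
by rewrite mul0r addr0 normrM ger0_norm // ler_piMr ?sin_max.
Qed.

End Spectral.

(** * Runs of the algorithm *)

Section Separation.
Variables (R : realType) (S : nat) (lam : 'I_S -> R).

(** As [m >= 2], the length [eta / (Mp m)] is at most the radius [eta / (2 Mp)] of [G]. So points of
    the new lattice that are too close would make [G] meet a nonzero translate of itself. *)
Lemma good_m_separated (eta Mp m : R) (Ep : set R) : 0 < eta -> 0 < Mp ->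
  good_m eta Mp Ep m -> (forall s, Ep (lam s)) ->
  lattice_separated lam (Mp * m) (eta / 2) Ep.
Proof.
move=> eta0 Mp0 [/andP[m2 _] /= G] Elam.
have m0 : 0 < m by lra.
have M0 : 0 < Mp * m by rewrite mulr_gt0.
have le : eta / (Mp * m) <= eta / (2 * Mp).
  by rewrite ler_pM2l // lef_pV2 ?posrE ?mulr_gt0 // mulrC ler_pM2l.
have r0 : 0 <= eta / (2 * Mp) by rewrite divr_ge0 ?mulr_ge0 ?ltW.
have EG x : Ep x -> Bset Ep (eta / (2 * Mp)) x.
  by move=> Ex; exists x; rewrite subrr normr0.
have divM x e : `|x| < e -> `|x / (Mp * m)| <= e / (Mp * m).
  by move=> xe; rewrite normrM [`|_^-1|]gtr0_norm ?invr_gt0 // ler_pM2r ?invr_gt0 // ltW.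
have MN : Mp * m != 0 by rewrite gt_eqF.
split=> // [s s' q q0|z s q Ez zs].
  rewrite mulrCA mulfV // mulr1 leNgt; apply/negP => /divM H.
  apply: (G q q0 (lam s')); first exact: EG.
  exists (lam s); split=> //; rewrite distrC; apply: le_trans le.
  apply: le_trans H; rewrite le_eqVlt; apply/orP; left; apply/eqP; congr `|_|.
  by move: (Mp * m) MN => M MN; field.
apply/eqP/negPn/negP => q0.
apply: (G q q0 (z / (Mp * m) - q%:~R / (Mp * m))); last by rewrite subrK; exact: EG.
exists (lam s); split=> //; apply: le_trans le.
have /divM H : `|z - (Mp * m * lam s + q%:~R)| < eta by lra.
apply: le_trans H; rewrite le_eqVlt; apply/orP; left; apply/eqP; congr `|_|.
by move: (Mp * m) MN => M MN; field.
Qed.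

(** At [M = 1] the separation comes from the gap [1 / 10] between [9 / 10] and 1. *)
Lemma E_init_separated (eta : R) : 0 < eta -> eta <= 1 / (8 * S%:R * (2 * S%:R - 1)) ->
  (forall s, 0 <= lam s <= 9 / 10) -> lattice_separated lam 1 (eta / 2) (@E_init R).
Proof.
move=> eta0 etaS lam01.
have q1 (q : int) : q != 0 -> (1 <= q%:~R :> R) \/ (q%:~R <= -1 :> R).
  move=> q0; have [h|h] := lerP 1 q; [left|right].
    by rewrite -[1]/(1%:~R) ler_int.
  by rewrite -[-1]/((-1)%:~R) ler_int; lia.
have eta8 : 0 < S%:R :> R -> eta <= 1 / 8.
  move=> S0; have S1 : 1 <= S%:R :> R by rewrite ler1n -(ltr0n R).
  apply: le_trans etaS _; rewrite !div1r lef_pV2 ?posrE ?mulr_gt0 //; try lra.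
  by nra.
have S0 (s : 'I_S) : 0 < S%:R :> R by rewrite ltr0n; apply: leq_trans (ltn_ord s).
split=> [s s' q q0|z s q|s].
- rewrite mulrCA mulfV // mulr1 !mul1r.
  (* For [S = 1], where [eta] may exceed [1 / 10], only translates of a single point are compared,
     at distance at least 1. *)
  have [S1|S1] := leqP S 1.
    have -> : s' = s by apply: ord_inj; have := ltn_ord s; have := ltn_ord s'; lia.
    rewrite opprD addrA subrr sub0r normrN; have e8 := eta8 (S0 s); clear eta8 S0.
    by case: (q1 q q0) => h; [rewrite ger0_norm; lra | rewrite ler0_norm; lra].
  clear eta8 S0; have S2 : 2 <= S%:R :> R by rewrite ler_nat.
  have eta48 : eta <= 1 / 48.
    apply: le_trans etaS _; rewrite !div1r lef_pV2 ?posrE ?mulr_gt0 //; try lra.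
    by nra.
  have /andP[? ?] := lam01 s; have /andP[? ?] := lam01 s'.
  by case: (q1 q q0) => h; [rewrite ler0_norm; lra | rewrite ger0_norm; lra].
- rewrite divr1 mul1r /E_init /= => /andP[? ?]; rewrite ltr_norml => /andP[? ?].
  have e8 := eta8 (S0 s); clear eta8 S0; have /andP[? ?] := lam01 s.
  by apply/eqP/negPn/negP => /q1[h|h]; lra.
- exact: lam01.
Qed.

End Separation.

(** * Success probability and cost along a run *)

Section Runs.
Variables (R : realType) (g : R -> R[i]) (K Nh : nat).
Variables (tau beta omega eta eps : R).
Variable chooseM : seq (table K Nh) -> R -> set R -> R.
Variable chooseE : seq (table K Nh) -> R -> set R -> set R -> set R.
Variable Lam : set R.

Local Notation stepf := (step tau beta omega eta chooseM chooseE).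
Local Notation psuccf := (psucc g tau beta omega eta eps chooseM chooseE Lam).
Local Notation weight s := (table_weight g (nextM chooseM s)).

Lemma psucc_ge0 f s : (forall M (o : table K Nh), 0 <= table_weight g M o) -> 0 <= psuccf f s.
Proof.
move=> w0; elim: f s => [|f IH] s /=; case: ifP => _ //; try by case: ifP.
by apply: sumr_ge0 => o _; rewrite mulr_ge0.
Qed.

Lemma sum_weight_lower (f : nat) (s : state R K Nh) (p t : R) (ok : pred (table K Nh)) :
  (forall M (o : table K Nh), 0 <= table_weight g M o) ->
  0 <= p -> 1 - p <= \sum_(o | ok o) weight s o ->
  (forall o, ok o -> 1 - t <= psuccf f (stepf s o)) -> 0 <= t ->
  1 - (t + p) <= \sum_o weight s o * psuccf f (stepf s o).
Proof.
move=> w0 p0 okp H t0.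
have ge0 : 0 <= \sum_o weight s o * psuccf f (stepf s o).
  by apply: sumr_ge0 => o _; rewrite mulr_ge0 ?psucc_ge0.
(* For [t >= 1] the claim is trivial; otherwise [1 - t] is positive and
   [(1 - p) (1 - t) >= 1 - (t + p)] applies. *)
have [t1|t1] := lerP 1 t; first by apply: le_trans ge0; lra.
apply: (@le_trans _ _ (\sum_(o | ok o) weight s o * psuccf f (stepf s o))); last first.
  rewrite [leRHS](bigID ok) /= lerDl; apply: sumr_ge0 => o _.
  by rewrite mulr_ge0 ?psucc_ge0.
apply: (@le_trans _ _ ((\sum_(o | ok o) weight s o) * (1 - t))).
  have : (1 - p) * (1 - t) <= (\sum_(o | ok o) weight s o) * (1 - t).
    by rewrite ler_wpM2r // subr_ge0 ltW.
  have : 0 <= p * t by rewrite mulr_ge0.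
  by lra.
by rewrite mulr_suml; apply: ler_sum => o oko; rewrite ler_wpM2l ?H.
Qed.

(** [r] counts the doublings of [M] that suffice to reach [eta / eps]. Each round uses up one of
    them and loses [p]; [ok] is the event that keeps the invariant [P]. *)
Lemma psucc_lower (P : state R K Nh -> Prop) (ok : R -> pred (table K Nh)) (p : R) :
  (forall M (o : table K Nh), 0 <= table_weight g M o) ->
  0 < eps -> 0 <= p ->
  (forall s, P s -> (0 < lvl s)%N /\ 0 < curM s) ->
  (forall s, P s -> stopped eta eps s -> success eps Lam s) ->
  (forall M, 1 - p <= \sum_(o | ok M o) table_weight g M o) ->
  (forall s o, P s -> ok (nextM chooseM s) o ->
     P (stepf s o) /\ 2 * curM s <= curM (stepf s o)) ->
  forall r f s, (r <= f)%N -> P s -> eta / eps <= curM s * 2 ^+ r ->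
    1 - r%:R * p <= psuccf f s.
Proof.
move=> w0 eps0 p0 Plvl Psucc okp Pstep.
elim=> [|r IH] f s rf Ps le.
  have [l0 M0] := Plvl s Ps.
  have st : stopped eta eps s.
    rewrite /stopped l0 /= ler_pdivrMr // mulrC -ler_pdivrMr //.
    by rewrite expr0 mulr1 in le.
  by case: f rf => [|f] _ /=; rewrite st (Psucc _ Ps st) mul0r subr0.
case: f rf => // f rf /=; case: ifP => st.
  rewrite (Psucc _ Ps st) gerBl mulr_ge0 //.
rewrite -natr1 mulrDl mul1r.
apply: (sum_weight_lower (ok := ok (nextM chooseM s))) => //; last by rewrite mulr_ge0.
move=> o oko; have [Po Mo] := Pstep s o Ps oko; apply: IH => //.
apply: le_trans le _; rewrite exprS mulrA ler_wpM2r ?exprn_ge0 // mulrC //.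
Qed.

(** The bound on [ttot] absorbs the whole history into the current [M]: as [M] at least doubles, the
    costs form a geometric series, hence the factor 2. *)
Definition run_bounds (s : state R K Nh) : Prop :=
  [/\ 0 < curM s, curM s <= 4 * (eta / eps), tmax s <= curM s * K%:R &
      ttot s <= 2 * curM s * ((2 * Nh)%:R * K%:R ^+ 2)].

Lemma sum_round_cost (M : R) : 0 <= M ->
  \sum_(k < K.+1) (2 * Nh)%:R * (M * k%:R) <= M * ((2 * Nh)%:R * K%:R ^+ 2).
Proof.
move=> M0; rewrite -mulr_sumr -mulr_sumr mulrCA ler_wpM2l // ler_wpM2l //.
rewrite big_ord_recl /= add0r; apply: (@le_trans _ _ (\sum_(i < K) K%:R)).
  by apply: ler_sum => i _; rewrite /bump /= add1n ler_nat ltn_ord.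
by rewrite sumr_const card_ord -[leLHS]mulr_natl expr2.
Qed.

Lemma run_bounds_post s : 0 < eps -> 0 < eta -> run_bounds s ->
  tmax s <= 4 * (eta * K%:R / eps) /\
  ttot s <= 8 * (eta * K%:R ^+ 2 * (2 * Nh)%:R / eps).
Proof.
move=> eps0 eta0 [M0 M4 tm tt]; split.
  apply: le_trans tm _; apply: le_trans (ler_wpM2r _ M4) _ => //.
  by rewrite le_eqVlt; apply/orP; left; apply/eqP; field; rewrite gt_eqF.
apply: le_trans tt _.
have c0 : 0 <= (2 * Nh)%:R * K%:R ^+ 2 :> R by rewrite mulr_ge0 ?exprn_ge0.
have : 2 * curM s <= 2 * (4 * (eta / eps)) by rewrite ler_wpM2l.
move=> /(ler_wpM2r c0) H; apply: le_trans H _.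
by rewrite le_eqVlt; apply/orP; left; apply/eqP; field; rewrite gt_eqF.
Qed.

(** Doubling ends the run within the fuel. A further round is played only while [M < eta / eps], and
    it multiplies [M] by at most 4, whatever the outcomes. *)
Lemma allruns_bounds f s (Post : state R K Nh -> Prop) :
  (forall h Mp Ep, 2 <= chooseM h Mp Ep <= 4) -> 0 < eps ->
  (forall s', run_bounds s' -> Post s') ->
  (0 < lvl s)%N -> run_bounds s -> eta / eps <= curM s * 2 ^+ f ->
  allruns tau beta omega eta eps chooseM chooseE f s Post.
Proof.
move=> cM eps0 RP; elim: f s => [|f IH] s l0 rb le; have [M0 M4 tm tt] := rb.
  have st : stopped eta eps s.
    rewrite /stopped l0 /= ler_pdivrMr // mulrC -ler_pdivrMr //.
    by rewrite expr0 mulr1 in le.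
  by rewrite /= st; exact: RP.
rewrite /=; case: ifPn => st; first exact: RP.
have ME : curM s < eta / eps.
  move: st; rewrite /stopped l0 /= -ltNge ltr_pdivlMr // => h.
  by rewrite ltr_pdivlMr // mulrC.
move=> o; have lN : (lvl s == 0%N) = false by rewrite gtn_eqF.
set m := chooseM (hist s) (curM s) (curE s).
have /andP[m2 m4] : 2 <= m <= 4 := cM _ _ _.
have nM : nextM chooseM s = curM s * m by rewrite /nextM lN.
have hm2 : 2 * curM s <= curM s * m by rewrite mulrC ler_pM2l.
have hm4 : curM s * m <= 4 * curM s by rewrite [leRHS]mulrC ler_pM2l.
apply: IH => //=; last first.
  by rewrite nM (le_trans le) // exprS mulrCA mulrA ler_wpM2r ?exprn_ge0.
split; rewrite /= ?nM; [lra|lra| |].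
  rewrite ge_max lexx andbT (le_trans tm) // ler_wpM2r //; lra.
have c0 : 0 <= (2 * Nh)%:R * K%:R ^+ 2 :> R by rewrite mulr_ge0 ?exprn_ge0.
have := ler_wpM2r c0 hm2.
have : 0 <= curM s * m by lra.
move=> /sum_round_cost; move: tt; move: ((2 * Nh)%:R * K%:R ^+ 2) => c1 tt.
by move: (\sum_(k < K.+1) _) => c2; lra.
Qed.

End Runs.

(** [x > 1 / 2] puts the binary logarithm above [-1], so its ceiling is a natural number; being the
    least sufficient exponent, it is at most any sufficient fuel. *)
Lemma ceil_log2 (R : realType) (x : R) : 1 / 2 < x ->
  exists L : nat, [/\ Num.ceil (ln x / ln 2) = L%:Z, x <= 2 ^+ L &
    forall F : nat, x <= 2 ^+ F -> (L <= F)%N].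
Proof.
move=> x12; have x0 : 0 < x by lra.
have l2 : 0 < ln 2 :> R by rewrite ln_gt0 // ltr1n.
have c0 : 0 <= Num.ceil (ln x / ln 2).
  rewrite ceil_ge0 ltr_pdivlMr // mulN1r -lnV ?posrE // ltr_ln ?posrE ?invr_gt0 //.
  by rewrite -[2^-1]div1r.
exists `|Num.ceil (ln x / ln 2)|%N; rewrite gez0_abs //; split=> //.
  rewrite -ler_ln ?posrE ?exprn_gt0 // lnXn // -[leRHS]mulr_natl -ler_pdivrMr //.
  by have := ceil_ge (ln x / ln 2); rewrite -{1}(gez0_abs c0) -pmulrn.
move=> F xF; rewrite -lez_nat gez0_abs // ceil_le_int -pmulrn ler_pdivrMr //.
by rewrite mulr_natl -lnXn // ler_ln ?posrE ?exprn_gt0.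
Qed.

(** * One round with accurate averages *)

Section Round.
Variables (R : realType) (S : nat) (lam : 'I_S -> R) (I : finType).
Variables (w nu : I -> R) (inc : 'I_S -> I) (g : R -> R[i]).
Variables (beta omega alpha eta eps : R) (K Nh : nat).
Let tau := tau_of beta omega.
Variable chooseM : seq (table K Nh) -> R -> set R -> R.
Variable chooseE : seq (table K Nh) -> R -> set R -> set R -> set R.

Hypothesis nuE : forall s, nu (inc s) = lam s.
Hypothesis gE : forall t, g t = spectral_mean w nu t.
Hypothesis w0 : forall i, 0 <= w i.
Hypothesis w1 : \sum_i w i = 1.
Hypothesis wb : forall s, beta <= w (inc s).
Hypothesis wo : \sum_(i | i \notin codom inc) w i <= omega.
Hypothesis S0 : (0 < S)%N.
Hypothesis a0 : 0 < alpha < (beta - omega) / 3.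
Hypothesis ob : omega < beta.
Hypothesis eta0 : 0 < eta.
Hypothesis etaS : eta <= 1 / (8 * S%:R * (2 * S%:R - 1)).
Hypothesis Keta : 3 * tau / eta <= K%:R.
Hypothesis lam01 : forall s, 0 <= lam s <= 9 / 10.
Hypothesis ruleM : forall h Mp Ep, 2 <= chooseM h Mp Ep <= 4 /\
  ((exists m, good_m eta Mp Ep m) -> good_m eta Mp Ep (chooseM h Mp Ep)).
Hypothesis ruleE : forall h M Ep Y, (exists E, adm_update Y M Ep E) ->
  adm_update Y M Ep (chooseE h M Ep Y).

(** [S >= 1] gives [eta <= 1 / 8], whence [3 tau / eta >= 24 tau]. *)
Lemma degree_lower : 24 * tau <= K%:R.
Proof.
have om0 : 0 <= omega by apply: le_trans wo; apply: sumr_ge0.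
have b1 : beta <= 1.
  apply: le_trans (wb (Ordinal S0)) _; rewrite -w1 (bigD1 (inc (Ordinal S0))) //= lerDl.
  exact: sumr_ge0.
have bo : 0 < beta - omega by rewrite subr_gt0.
have t0 : 0 < tau.
  by rewrite /tau /tau_of mulr_gt0 ?divr_gt0 ?pi_gt0 // ln_gt0 // ltr_pdivlMr //; lra.
have S1 : 1 <= S%:R :> R by rewrite ler1n.
have eta8 : eta <= 1 / 8.
  apply: le_trans etaS _; rewrite !div1r lef_pV2 ?posrE ?mulr_gt0 //; try lra.
  by nra.
apply: le_trans Keta; rewrite ler_pdivlMr //.
have := ler_wpM2l (ltW t0) eta8; lra.
Qed.

Lemma round_correct h M Ep (o : table K Nh) (Y := Yset K tau beta omega (yest R o)) :
  0 < M -> lattice_separated lam M (eta / 2) Ep -> table_good g M alpha o ->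
  [/\ adm_update Y M Ep (chooseE h M Ep Y),
      forall s, chooseE h M Ep Y (lam s) &
      forall x, chooseE h M Ep Y x -> exists s, `|x - lam s| <= eta / 2 / M].
Proof.
move=> M0 sep /forallP good.
have hyp : signal_hyp w nu (mem (codom inc)) beta omega alpha K M (yest R o).
  split; split=> //.
  - by move=> i /codomP[s ->].
  - by exists (inc (Ordinal S0)); exact: codom_f.
  - exact: degree_lower.
  - move=> k kK; have := good (Ordinal (kK : (k < K.+1)%N)).
    by rewrite /= gE.
have cov := signal_lattice_cover hyp Keta eta0.
have nuinc : nu \o inc = lam by apply/funext => s; exact: nuE.
rewrite nuinc in cov.
have r0 : 0 < eta / 2 by rewrite divr_gt0.
have adm : adm_update Y M Ep (chooseE h M Ep Y).
  by apply: ruleE; apply: (adm_update_exists r0 _ cov sep); rewrite gt_eqF.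
by have [E1 E2] := adm_update_correct r0 M0 cov sep adm.
Qed.

(** The radius [eta / 2 / curM] is the one that [good_m_exists] requires for the next multiplier;
    the output bound [eps] follows from it at stopping time. *)
Definition on_track (s : state R K Nh) : Prop :=
  [/\ (0 < lvl s)%N, 0 < curM s, valid s, forall i, curE s (lam i) &
      forall x, curE s x -> exists i, `|x - lam i| <= eta / 2 / curM s].

Local Notation stepf := (step tau beta omega eta chooseM chooseE).

Lemma on_track_init o : table_good g 1 alpha o ->
  on_track (stepf (init_state R K Nh) o).
Proof.
move=> good; have sep := E_init_separated eta0 etaS lam01.
have [adm E1 E2] := round_correct [:: o] ltr01 sep good.
by split=> //=; apply/asboolP.
Qed.

Lemma on_track_step s o : on_track s -> table_good g (nextM chooseM s) alpha o ->
  on_track (stepf s o) /\ 2 * curM s <= curM (stepf s o).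
Proof.
move=> [l0 M0 vs Elam EB].
have lN : (lvl s == 0%N) = false by rewrite gtn_eqF.
have gm : good_m eta (curM s) (curE s) (chooseM (hist s) (curM s) (curE s)).
  by apply: (ruleM _ _ _).2; exact: (good_m_exists S0 eta0 etaS M0 EB).
rewrite /nextM lN; set m := chooseM _ _ _ in gm *.
have /andP[m2 _] := gm.1.
have Mm : 0 < curM s * m by rewrite mulr_gt0 //; lra.
have sep := good_m_separated eta0 M0 gm Elam.
move=> good; have [adm E1 E2] := round_correct (rcons (hist s) o) Mm sep good.
split; last by rewrite /= /nextM lN -/m mulrC ler_pM2l.
split; rewrite /= /nextM /Defs.prevE /validM ?lN -?/m //.
by rewrite vs /=; apply/andP; split; apply/asboolP.
Qed.

Lemma on_track_success s : 0 < eps -> on_track s -> stopped eta eps s ->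
  success eps [set x | exists i, x = lam i] s.
Proof.
move=> eps0 [l0 M0 vs Elam EB] /andP[_ st]; rewrite /success vs /=; apply/asboolP.
split=> [_ [i ->] //|x /EB[i xi]].
exists (lam i); split; first by exists i.
apply: le_trans xi _; apply: le_trans st; rewrite ler_pM2r ?invr_gt0 //.
by rewrite ler_pdivrMr // ler_peMr ?ler1n ?ltW.
Qed.

End Round.

Theorem theorem2 (R : realType) :
  exists C1 C2 : R, 0 < C1 /\ 0 < C2 /\
  forall (n : nat) (V : 'M[R[i]]_n) (mu : 'I_n -> R)
         (S : nat) (psis : 'I_S -> 'cV[R[i]]_n) (lam : 'I_S -> R)
         (c : 'I_S -> R[i]) (psires : 'cV[R[i]]_n) (cres : R[i])
         (psi : 'cV[R[i]]_n)
         (beta omega eps rho alpha eta : R) (K : nat),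
    (* the quantum data *)
    adj V *m V = 1%:M ->
    (forall j, 0 <= mu j <= 1) ->
    (forall s s', cinner (psis s) (psis s') = (s == s')%:R) ->
    (forall s, Hmat V mu *m psis s = creal (lam s) *: psis s) ->
    cinner psires psires = 1 ->
    (forall s, cinner (psis s) psires = 0) ->
    psi = \sum_(s < S) c s *: psis s + cres *: psires ->
    cinner psi psi = 1 ->
    (0 < S)%N ->
    0 < beta ->
    (forall s, beta <= cmod (c s) ^+ 2) ->
    cmod cres ^+ 2 <= omega ->
    omega < beta ->
    (forall s, 0 <= lam s <= 9 / 10) ->
    (* parameters *)
    0 < eps -> eps < 2 * eta ->
    0 < rho < 1 ->
    0 < alpha < (beta - omega) / 3 ->
    0 < eta -> eta <= 1 / (8 * S%:R * (2 * S%:R - 1)) ->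
    3 * tau_of beta omega / eta <= K%:R ->
    let tau := tau_of beta omega in
    let Nh := Nhalf alpha rho eta eps K in   (* N_HR = 2 * Nh *)
    let Lam := [set x | exists s, x = lam s] in
    let g := hmean V mu psi in
    forall (chooseM : seq (table K Nh) -> R -> set R -> R)
           (chooseE : seq (table K Nh) -> R -> set R -> set R -> set R),
    (* the strategy obeys the rule for m_l whenever possible *)
    (forall h Mp Ep, 2 <= chooseM h Mp Ep <= 4 /\
       ((exists m, good_m eta Mp Ep m) -> good_m eta Mp Ep (chooseM h Mp Ep))) ->
    (* and performs step (iv) correctly whenever possible *)
    (forall h M Ep Y, (exists E, adm_update Y M Ep E) ->
       adm_update Y M Ep (chooseE h M Ep Y)) ->
    forall F : nat, eta / eps <= 2 ^+ F ->
      1 - rho <= psucc g tau beta omega eta eps chooseM chooseE Lam F.+1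
                   (init_state R K Nh) /\
      allruns tau beta omega eta eps chooseM chooseE F.+1 (init_state R K Nh)
        (fun st => tmax st <= C1 * (eta * K%:R / eps) /\
                   ttot st <= C2 * (eta * K%:R ^+ 2 * (2 * Nh)%:R / eps)).
Proof.
exists 4, 8; do 2!split=> //.
move=> n V mu S psis lam c psires cres psi beta omega eps rho alpha eta K.
move=> Vunit mu01 ortho eigen res1 res0 psiE psi1 S0 beta0 cb cresw ob lam01.
move=> eps0 eps2 rho01 a0 eta0 etaS Keta tau Nh Lam g chooseM chooseE ruleM ruleE F etaF.
have ruleM' h Mp Ep := (ruleM h Mp Ep).1.
pose w := spec_weight V c psires cres; pose nu := spec_freq mu lam.
have gE t : g t = spectral_mean w nu t := hmean_spectral Vunit ortho eigen res0 psiE t.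
have w0 i : 0 <= w i := spec_weight_ge0 V c psires cres i.
have w1 : \sum_i w i = 1 := sum_spec_weight Vunit ortho eigen res0 psiE psi1.
have wo : \sum_(i | i \notin codom (@inl 'I_S 'I_n)) w i <= omega.
  by rewrite (sum_spec_weight_res _ Vunit _ _ res1).
have g1 t : `|complex.Re (g t)| <= 1 /\ `|complex.Im (g t)| <= 1.
  by rewrite gE; exact: spectral_mean_le1.
have etaeps : 1 / 2 < eta / eps by rewrite ltr_pdivlMr //; lra.
have [L [LE etaL Lmin]] := ceil_log2 etaeps.
have /andP[alpha0 _] := a0; have /andP[rho0 _] := rho01.
have [Nh0 fail] := Nhalf_failure K alpha0 rho01 LE.
pose p := rho / (L%:R + 1).
have p0 : 0 <= p by rewrite divr_ge0 // ?addr_ge0 // ltW.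
have W0 M (o : table K Nh) : 0 <= table_weight g M o.
  rewrite table_weightE; apply: prodr_ge0 => i _; apply: coin_ge0 => j.
  by rewrite /table_mean; case: ifP => _; have [] := g1 (M * (nat_of_ord j.1.1)%:R).
have okp M : 1 - p <= \sum_(o | table_good g M alpha o) table_weight g M (o : table K Nh).
  by apply: le_trans (table_concentration M K Nh0 alpha0 g1); rewrite lerD2l lerN2.
split.
  have -> : psucc g tau beta omega eta eps chooseM chooseE Lam F.+1 (init_state R K Nh) =
    \sum_o table_weight g (nextM chooseM (init_state R K Nh)) o *
      psucc g tau beta omega eta eps chooseM chooseE Lam F
        (step tau beta omega eta chooseM chooseE (init_state R K Nh) o) by [].
  (* Round 0, at [M = 1], costs one [p]; each of the at most [L] later rounds costs another. *)
  have -> : 1 - rho = 1 - (L%:R * p + p).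
    by rewrite /p; field; rewrite gt_eqF // ltr_wpDl.
  apply: (sum_weight_lower (ok := table_good g 1 alpha)) => //; last by rewrite mulr_ge0.
  move=> o good.
  apply: (psucc_lower (P := fun s => on_track lam eta s)
    (ok := fun M => table_good g M alpha)) => //.
  - by move=> s [].
  - by move=> s; exact: on_track_success.
  - by move=> s o'; exact: (on_track_step (inc := inl) _ gE).
  - exact: Lmin.
  - exact: (on_track_init (inc := inl) (alpha := alpha) chooseM _ gE).
  - by rewrite /= /nextM /= mul1r.
move=> o; apply: allruns_bounds => //.
- by move=> s'; exact: run_bounds_post.
(* After round 0, [M = 1], and [1 <= 4 eta / eps] follows from [eps < 2 eta]. *)
- split; rewrite /= /nextM /=.
  + by [].
  + by lra.
  + by rewrite ge_max lexx andbT mul1r.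
  + rewrite add0r mulr1; apply: le_trans (sum_round_cost K Nh ler01) _.
    by rewrite mul1r ler_peMl ?mulr_ge0 ?exprn_ge0 // ler1n.
- by rewrite /= /nextM /= mul1r.
Qed.
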